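(* Let $G$ be a finite group and let $N$ be a normal Hall subgroup of $G$. The following are true: (1) If $G$ is a pseudo-$M$-group, then $N$ is a pseudo-$M$-group. (2) If $p$ is a prime and $G$ is a pseudo-$M_p$-group, then $N$ is also a pseudo-$M_p$-group.
   Context: All groups are finite. A Hall subgroup of $G$ is a subgroup whose order is coprime to its index. $\mathrm{Irr}(G)$ is the set of irreducible complex characters of $G$, and for a prime $p$, $\mathrm{IBr}(G)$ is the set of irreducible Brauer characters of $G$ with respect to $p$; $\psi^G$ denotes induction of (Brauer) characters. For $\chi\in\mathrm{Irr}(G)$ put $D(\chi)=\{\psi(1)\mid \psi\in\mathrm{Irr}(H)\text{ for some }H\le G\text{ and }\psi^G=\chi\}$. The group $G$ is a pseudo-$M$-group if $\gcd(D(\chi))=1$ for every $\chi\in\mathrm{Irr}(G)$. For $\varphi\in\mathrm{IBr}(G)$ put $S(\varphi)=\{\psi\in\mathrm{IBr}(H)\mid H\le G,\ \psi^G=\varphi\}$; $\varphi$ is pseudo monomial if $\gcd\{\psi(1)\mid\psi\in S(\varphi)\}=1$. The group $G$ is a pseudo-$M_p$-group if every $\varphi\in\mathrm{IBr}(G)$ is pseudo monomial. Subgroups $H$ are allowed to equal $G$. *)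

(* Defs.v *)
From HB Require Import structures.
From mathcomp Require Import all_boot all_order all_algebra all_fingroup.
From mathcomp Require Import all_solvable all_field all_character.

Set Implicit Arguments.
Unset Strict Implicit.
Unset Printing Implicit Defensive.

Import GroupScope GRing.Theory.
Local Open Scope ring_scope.

(* gcd of a possibly infinite set of natural numbers *)
Definition is_gcd_of (D : nat -> Prop) (g : nat) : Prop :=
  (forall n, D n -> (g %| n)%N) /\
  (forall d, (forall n, D n -> (d %| n)%N) -> (d %| g)%N).

Definition char_degrees (gT : finGroupType) (G : {group gT}) (chi : 'CF(G))
    (n : nat) : Prop :=
  exists (H : {group gT}) (psi : 'CF(H)),
    [/\ H \subset G, psi \in irr H, 'Ind[G] psi = chi & psi 1%g = n%:R].

Definition pseudoM_group (gT : finGroupType) (G : {group gT}) : Prop :=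
  forall chi : 'CF(G), chi \in irr G -> is_gcd_of (char_degrees chi) 1.

Record algInt : Type := AlgInt { algInt_val : algC; _ : algInt_val \in Aint }.

HB.instance Definition _ := [isSub for algInt_val].
HB.instance Definition _ := [Choice of algInt by <:].
HB.instance Definition _ := [SubChoice_isSubComNzRing of algInt by <:].

(* Brauer characters are taken with respect to a maximal ideal M, containing p,
   of the ring algInt of algebraic integers. Such an M is given by the quotient
   map red : algInt -> F = algInt / M, i.e. by a surjective ring morphism onto
   a field of characteristic p; such a field is an algebraic closure of F_p.  *)
Section BrauerCharacters.

Variables (p : nat) (F : closedFieldType) (red : {rmorphism algInt -> F}).

Definition p'_unity_root (z : algInt) : Prop :=
  exists m : nat, ~~ (p %| m)%N /\ z ^+ m = 1.

(* A Brauer character is a function on the p-regular elements of G; it is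
   represented by its extension by zero to a class function on G. Since red is
   injective on the roots of unity of order prime to p, the lifts zs of the
   eigenvalues of rG g are unique up to order. *)
Definition is_Brauer_char_of (gT : finGroupType) (G : {group gT}) (n : nat)
    (rG : mx_representation F G n) (phi : 'CF(G)) : Prop :=
  (forall g, ~~ p^'.-elt g -> phi g = 0) /\
  (forall g, g \in G -> p^'.-elt g ->
     exists zs : seq algInt,
       [/\ forall z, z \in zs -> p'_unity_root z,
           char_poly (rG g) = \prod_(z <- zs) ('X - (red z)%:P)
         & phi g = \sum_(z <- zs) algInt_val z]).

Definition IBr (gT : finGroupType) (G : {group gT}) (phi : 'CF(G)) : Prop :=
  exists (n : nat) (rG : mx_representation F G n),
    mx_irreducible rG /\ is_Brauer_char_of rG phi.

(* Conjugation preserves p-regularity, so 'Ind of the extension by zero of a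
   Brauer character is the extension by zero of the induced one. *)
Definition Brauer_degrees (gT : finGroupType) (G : {group gT}) (phi : 'CF(G))
    (n : nat) : Prop :=
  exists (H : {group gT}) (psi : 'CF(H)),
    [/\ H \subset G, IBr psi, 'Ind[G] psi = phi & psi 1%g = n%:R].

Definition pseudo_monomial (gT : finGroupType) (G : {group gT})
    (phi : 'CF(G)) : Prop :=
  is_gcd_of (Brauer_degrees phi) 1.

Definition pseudoMp_group (gT : finGroupType) (G : {group gT}) : Prop :=
  forall phi : 'CF(G), IBr phi -> pseudo_monomial phi.

End BrauerCharacters.

(* Main.v *)
Require Import Defs.
From HB Require Import structures.
From mathcomp Require Import all_boot all_order all_algebra all_fingroup.
From mathcomp Require Import all_solvable all_field all_character.
From mathcomp Require Import ring.

(* Both parts are one statement about representations over an algebraically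
   closed field F, complex in (1) and of characteristic p in (2).

   G is solvable by an argument of Taketa: let S be a perfect normal subgroup
   and V irreducible of minimal degree among those on which S acts nontrivially.
   If V is induced from H < G, the permutation module on G / H is reducible of
   dimension at most dim V, hence S acts trivially on it, i.e. S <= H. By
   Clifford's theorem the degree of a simple S-submodule of V divides the degree
   of every module inducing V; so it is 1, and S, being perfect, acts trivially.

   Let now W be an irreducible N-module, V an irreducible G-module over W, U an
   H-module inducing V and U0 a simple submodule of the restriction of U to
   M = H :&: N. The N-module Y generated by U0 inside V is induced from U0, and
   its composition factors are conjugate to W, so dim Y = k * dim W. As G is
   solvable, dim Y = |N : M| * dim U0 divides |N| and dim V / dim W divides
   |G : N|; hence k divides the coprime numbers |N| and |G : N|, so k = 1 and a
   conjugate of W is induced from U0. Since dim U0 divides dim U, a common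
   divisor of the degrees of the modules inducing W divides those of the modules
   inducing V, so it is 1.

   For (2) one needs that the Brauer character of an induced module is the
   induced Brauer character. The matrix of a p-regular g is lifted to a block
   matrix P over the algebraic integers. For p ^ N = 1 modulo the order of g, the
   diagonal blocks of P ^ (p ^ N) are the (p ^ N)-th powers of those of P, and for
   large N the trace of the (p ^ N)-th power of a lift is congruent to the value
   of the Brauer character modulo any given power of p, locally at the kernel of
   the reduction map. *)

Set Implicit Arguments.
Unset Strict Implicit.
Unset Printing Implicit Defensive.

Import GroupScope GRing.Theory Num.Theory.
Local Open Scope ring_scope.

(** * Eigenvalues and traces of powers *)

(** By Cayley-Hamilton, applying to [u] the linear factors of the characteristic polynomial one at a
    time ends in 0; the last nonzero vector on the way is an eigenvector. [T] may be any predicate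
    stable under all [A - a], so no matrix describing it is needed. *)
Lemma closed_eigenvector_in (F : closedFieldType) m (A : 'M[F]_m)
    (T : 'rV[F]_m -> Prop) (u : 'rV[F]_m) :
    (forall a v, T v -> T (v *m A - a *: v)) -> T u -> u != 0 ->
  exists v a, [/\ T v, v != 0 & v *m A = a *: v].
Proof.
case: m A T u => [|m] A T u TA Tu nzu; first by rewrite thinmx0 eqxx in nzu.
have [s def_s] := closed_field_poly_normal (char_poly A).
have: u *m \prod_(a <- s) (A - a%:M) = 0.
  have := Cayley_Hamilton A; rewrite def_s (monicP (char_poly_monic A)) scale1r.
  rewrite rmorph_prod /= => sA0; rewrite -[RHS](mulmx0 _ u) -sA0; congr (_ *m _).
  by apply: eq_bigr => a _; rewrite rmorphB /= horner_mx_X horner_mx_C.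
elim: s {def_s} => [|a s IHs] in u Tu nzu *.
  by rewrite big_nil mulmx1 => u0; rewrite u0 eqxx in nzu.
have defA : u *m (A - a%:M) = u *m A - a *: u by rewrite mulmxBr mul_mx_scalar.
rewrite big_cons [_ * _]/(_ *m _) mulmxA defA.
have [/eqP | nz_uA] := eqVneq (u *m A - a *: u) 0; last exact: IHs (TA _ _ Tu) _.
by rewrite subr_eq0 => /eqP uAa _; exists u, a.
Qed.

Lemma char_poly_sim (F : fieldType) n (A1 A2 B : 'M[F]_n) :
  B \in unitmx -> A1 *m B = B *m A2 -> char_poly A1 = char_poly A2.
Proof.
rewrite unitmxE unitfE => uB defB.
have nzB : \det (map_mx polyC B) != 0 by rewrite det_map_mx polyC_eq0.
apply: (mulIf nzB); rewrite -det_mulmx [RHS]mulrC -det_mulmx; congr (\det _).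
rewrite /char_poly_mx mulmxBl mulmxBr -!map_mxM defB scalar_mxC.
by [].
Qed.

(** Triangularization: completing an eigenvector to a basis makes the matrix block triangular, and
    the induction continues with the lower right block. *)
Lemma char_poly_mxtrace_expr (F : closedFieldType) n (A : 'M[F]_n) :
  exists2 s : seq F, char_poly A = \prod_(a <- s) ('X - a%:P)
    & forall k, \tr (A ^+ k) = \sum_(a <- s) a ^+ k.
Proof.
elim: n A => [|n IHn] A.
  exists [::] => [|k]; rewrite big_nil.
    by rewrite /char_poly det_mx00.
  by rewrite /mxtrace big_ord0.
have [v [a [_ nzv vA]]] :
  exists (v : 'rV_n.+1) a, [/\ True, v != 0 & v *m A = a *: v].
  have nz_e : (delta_mx 0 0 : 'rV[F]_n.+1) != 0.
    by apply/eqP=> /matrixP/(_ 0 0)/eqP; rewrite !mxE !eqxx oner_eq0.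
  exact: (closed_eigenvector_in (A := A) (fun _ _ _ => I) I nz_e).
(* [row_ebase v] is invertible and its first row is a nonzero multiple of [v]. *)
pose B : 'M[F]_(1 + n) := row_ebase v.
have uB : B \in unitmx by apply: row_ebase_unit.
have Bu : exists c, usubmx B = c *: v.
  have [c def_c] : exists c, v = c *: usubmx B.
    exists (col_ebase v 0 0).
    have pidB : pid_mx 1 *m B = usubmx B.
      rewrite -{1}[B]vsubmxK pid_mx_row (@mul_row_col _ 1 1 n).
      by rewrite mul0mx addr0 mul1mx.
    rewrite -pidB -{1}[v]mulmx_ebase rank_rV nzv -mulmxA.
    by rewrite [col_ebase v]mx11_scalar mul_scalar_mx mxE eqxx mulr1n.
  have nzc: c != 0 by apply: contraNneq nzv => c0; rewrite def_c c0 scale0r.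
  by exists c^-1; rewrite def_c scalerA mulVf ?scale1r.
pose C : 'M[F]_(1 + n) := B *m A *m invmx B.
have defBA : A *m invmx B = invmx B *m C by rewrite /C !mulmxA mulVmx // mul1mx.
have Cu : usubmx C = a *: row_mx 1%:M 0.
  rewrite /C -!mul_usub_mx; have [c Bc] := Bu.
  rewrite Bc -scalemxAl vA scalerA mulrC -scalerA -Bc -scalemxAl; congr (_ *: _).
  by rewrite mul_usub_mx mulmxV // scalar_mx_block block_mxEv col_mxKu.
have defC : C = block_mx a%:M 0 (dlsubmx C) (drsubmx C).
  rewrite -{1}[C]vsubmxK -{1}[dsubmx C]hsubmxK Cu scale_row_mx scaler0.
  by rewrite block_mxEv scalemx1.
have [s def_s tr_s] := IHn (drsubmx C).
have AX k : A ^+ k *m invmx B = invmx B *m C ^+ k.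
  elim: k => [|k IHk]; first by rewrite !expr0 mulmx1 mul1mx.
  by rewrite !exprSr -![_ * _]/(_ *m _) -mulmxA defBA mulmxA IHk !mulmxA.
have trX k : \tr (A ^+ k) = \tr (C ^+ k).
  by rewrite -[A ^+ k](mulmxKV uB) AX mxtrace_mulC mulmxA mulmxV ?mul1mx.
have CX k : exists D, C ^+ k = block_mx (a ^+ k)%:M 0 D (drsubmx C ^+ k).
  elim: k => [|k [D IHk]]; first by exists 0; rewrite !expr0 -scalar_mx_block.
  rewrite exprSr IHk {2}defC -[_ * block_mx _ _ _ _]/(_ *m _) mulmx_block.
  rewrite !mul0mx !mulmx0 !addr0 !add0r -scalar_mxM -exprSr; eexists; congr block_mx.
  by rewrite exprSr.
exists (a :: s) => [|k]; rewrite big_cons.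
  have -> : char_poly A = char_poly C.
    by apply: (@char_poly_sim _ _ _ _ (invmx B)); rewrite ?unitmx_inv.
  rewrite /char_poly /char_poly_mx {1}defC map_block_mx (@scalar_mx_block _ 1 n).
  rewrite opp_block_mx add_block_mx map_mx0 oppr0 addr0 det_lblock.
  rewrite -/(char_poly_mx (drsubmx C)) -/(char_poly (drsubmx C)) -{}def_s.
  by congr (_ * _); rewrite det_mx11 !mxE eqxx !mulr1n.
by rewrite trX; have [D ->] := CX k; rewrite mxtrace_block tr_s mxtrace_scalar.
Qed.

(** * Clifford theory over an algebraically closed field *)

Section SubgroupTranslates.

Variables (F : fieldType) (gT : finGroupType) (G H : {group gT}) (n : nat).
Variable rG : mx_representation F G n.

Lemma sum_translates_module (U : 'M_n) : mxmodule rG (\sum_(x in G) U *m rG x)%MS.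
Proof.
apply/mxmoduleP=> x Gx; rewrite sumsmxMr; apply/sumsmx_subP=> y Gy.
by rewrite -mulmxA -repr_mxM // (sumsmx_sup (y * x)%g) ?groupM.
Qed.

Lemma sum_translates_irr (U : 'M_n) :
  mx_irreducible rG -> U != 0 -> (\sum_(x in G) U *m rG x :=: 1%:M)%MS.
Proof.
case=> _ _ irrG nzU; apply/eqmxP; rewrite submx1 irrG ?submx1 //.
  exact: sum_translates_module.
rewrite -submx0; apply: contra nzU => /sumsmx_subP/(_ 1%g (group1 G)).
by rewrite repr_mx1 mulmx1 submx0.
Qed.

Lemma sum_rcosets_translates (sHG : H \subset G) (U : 'M_n) :
    mxmodule (subg_repr rG sHG) U ->
  (\sum_(x in G) U *m rG x :=: \sum_(A in rcosets H G) U *m rG (repr A))%MS.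
Proof.
move=> modU; apply/eqmxP/andP; split; apply/sumsmx_subP; first move=> x Gx.
  rewrite (sumsmx_sup (H :* x)) //; first by apply/rcosetsP; exists x.
  case: repr_rcosetP => h Hh.
  rewrite repr_mxM ?(subsetP sHG h) // mulmxA; apply: submxMr.
  have := mxmoduleP modU (h^-1)%g; rewrite groupV => /(_ Hh) /= sUh.
  by rewrite -{1}[U](repr_mxKV rG (subsetP sHG h Hh)) submxMr.
move=> _ /rcosetsP[x Gx ->]; case: repr_rcosetP => h Hh.
by rewrite (sumsmx_sup (h * x)%g) // groupM // (subsetP sHG).
Qed.

Lemma mxrank_sum_translates (sHG : H \subset G) (U : 'M_n) :
    mxmodule (subg_repr rG sHG) U ->
  (\rank (\sum_(x in G) U *m rG x) <= #|G : H| * \rank U)%N.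
Proof.
move/sum_rcosets_translates=> ->; apply: leq_trans (mxrank_sum_leqif _).1 _ => /=.
rewrite -sum_nat_const; apply: leq_sum => A _; exact: mxrankM_maxl.
Qed.

End SubgroupTranslates.

Lemma val_submod_simple (F : fieldType) (gT : finGroupType) (G : {group gT}) n
    (rG : mx_representation F G n) (U : 'M_n) (modU : mxmodule rG U)
    (W : 'M_(\rank U)) :
  mxsimple (submod_repr modU) W -> mxsimple rG <<val_submod W>>%MS.
Proof.
case=> modW nzW simW; split.
- by rewrite (eqmx_module _ (genmxE _)) val_submod_module.
- by rewrite (eqmx_eq0 (genmxE _)) val_submod_eq0.
move=> V modV; rewrite !genmxE => sVW nzV.
have sVU := submx_trans sVW (val_submodP W).
suffices: (W <= <<in_submod U V>>)%MS by rewrite genmxE -val_submodS in_submodK.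
apply: simW; rewrite ?(eqmx_module _ (genmxE _)) ?in_submod_module //.
  by rewrite genmxE -val_submodS in_submodK.
by rewrite (eqmx_eq0 (genmxE _)) -val_submod_eq0 in_submodK.
Qed.

Section CliffordDegrees.

Variables (F : closedFieldType) (gT : finGroupType) (G H : {group gT}).
Hypothesis nsHG : H <| G.
Variables (n : nat) (rG : mx_representation F G n).
Hypothesis irrG : mx_irreducible rG.

Let sHG := normal_sub nsHG.
Let rH := subg_repr rG sHG.

(** By Clifford's theorem the whole module is a sum of translates of [M], so [M'] is isomorphic to
    one of them. *)
Lemma Clifford_simple_rank M M' :
  mxsimple rH M -> mxsimple rH M' -> \rank M = \rank M'.
Proof.
move=> simM simM'; have [X /subsetP sXG [def1 _]] := Clifford_basis irrG simM.
have [||| x Xx isoM] := hom_mxsemisimple_iso (P := mem X)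
    (W := fun x => M *m rG x) (f := 1%:M) simM'.
- by move=> x Xx _; apply: Clifford_simple simM (sXG x Xx).
- exact: scalar_mx_hom.
- by rewrite mulmx1 def1 submx1.
by rewrite -(mxrank_iso isoM) mxrankMfree ?repr_mx_free ?sXG.
Qed.

Lemma dvdn_Clifford_simple_rank M : mxsimple rH M -> (\rank M %| n)%N.
Proof.
move=> simM; have [X /subsetP sXG [def1 dxX]] := Clifford_basis irrG simM.
have rn: \rank (\sum_(x in X) M *m rG x)%MS = n by rewrite def1 mxrank1.
suffices: (\rank M %| \rank (\sum_(x in X) M *m rG x)%MS)%N by rewrite rn.
rewrite (mxdirectP dxX) /= dvdn_sum // => x Xx.
by rewrite mxrankMfree ?repr_mx_free ?sXG.
Qed.

(* The operator [X |-> P X g] acts on the nonzero space of [H]-homomorphisms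
   from [M] to the whole module; the image of an eigenvector is [G]-stable. *)
Lemma Clifford_homogeneous_cyclic g M :
    G \subset H <*> <[g]> -> g \in G -> mxsimple rH M -> mx_iso rH M (M *m rG g) ->
  n = \rank M.
Proof.
move=> sGHg Gg simM [f uf homf defMg]; have [modM nzM _] := simM.
pose r := \rank M; pose E : 'M_(r, n) := row_base M.
have defE: (E :=: M)%MS by apply: eq_row_base.
have freeE: row_free E by apply: row_base_free.
have [sM EJ]: exists sM : gT -> 'M_r, forall h, h \in H -> sM h *m E = E *m rG h.
  exists (submod_repr modM) => h Hh; have := val_submodJ modM 1%:M Hh.
  by rewrite /val_submod /= !mul1mx.
have freeEg: row_free (E *m rG g) by rewrite /row_free mxrankMfree ?repr_mx_free.
have [P defP]: exists P, P *m (E *m rG g) = E *m f.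
  exists (E *m f *m pinvmx (E *m rG g)); rewrite mulmxKpV //.
  by rewrite (eqmxMr f defE) (eqmxMr (rG g) defE) defMg.
have uP: P \in unitmx.
  rewrite -row_free_unit -row_leq_rank.
  have rPEg: \rank (P *m (E *m rG g)) = r.
    by rewrite defP mxrankMfree ?row_free_unit // (eqnP freeE).
  exact: leq_trans (eq_leq (esym rPEg)) (mxrankM_maxl _ _).
(* [P] intertwines [sM] with its conjugate under [g]; this is why [Phi] preserves the space of
   homomorphisms [T]. *)
have PJ h : h \in H -> P *m sM (g * h * g^-1)%g = sM h *m P.
  move=> Hh; have Gh := subsetP sHG h Hh.
  have Hhg: (g * h * g^-1)%g \in H.
    by rewrite -mulgA -[g in (g * _)%g]invgK -conjgE memJ_norm ?groupV //
       (subsetP (normal_norm nsHG)).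
  have Ghg := subsetP sHG _ Hhg; apply: (row_free_inj freeEg).
  change (P *m sM (g * h * g^-1)%g *m (E *m rG g) = sM h *m P *m (E *m rG g)).
  have -> : P *m sM (g * h * g^-1)%g *m (E *m rG g) = P *m (E *m rG g) *m rG h.
    rewrite -mulmxA [sM _ *m _]mulmxA EJ // -!mulmxA -!repr_mxM //.
    by rewrite mulgKV.
  rewrite -[sM h *m P *m _]mulmxA defP [sM h *m _]mulmxA EJ //.
  have homE: (E <= dom_hom_mx rH f)%MS by rewrite defE.
  exact/esym/(hom_mxP homE).
pose Phi := lin_mx (mulmxr (rG g) \o mulmx P : 'M_(r, n) -> 'M_(r, n)).
pose T v := forall h, h \in H -> sM h *m vec_mx v = vec_mx v *m rG h.
have PhiE v : v *m Phi = mxvec (P *m vec_mx v *m rG g).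
  by rewrite -{1}[v]vec_mxK mul_vec_lin.
have T_Phi a v : T v -> T (v *m Phi - a *: v).
  move=> Tv h Hh; rewrite PhiE linearB linearZ /= mxvecK mulmxBr mulmxBl.
  have Gh := subsetP sHG h Hh.
  have Hhg: (g * h * g^-1)%g \in H.
    by rewrite -mulgA -[g in (g * _)%g]invgK -conjgE memJ_norm ?groupV //
       (subsetP (normal_norm nsHG)).
  rewrite -scalemxAl -scalemxAr Tv //; congr (_ - _).
  rewrite !mulmxA -PJ // -[P *m sM _ *m _]mulmxA Tv // -!mulmxA -!repr_mxM ?(subsetP sHG _ Hhg) //.
  by rewrite mulgKV.
have [||v [a [Tv nzv vPhi]]] := closed_eigenvector_in T_Phi (u := mxvec E).
- by move=> h Hh; rewrite mxvecK EJ.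
- by rewrite mxvec_eq0 -mxrank_eq0 (eqnP freeE) mxrank_eq0.
pose X := vec_mx v; have PXg: P *m X *m rG g = a *: X.
  by apply: (can_inj mxvecK); rewrite -PhiE vPhi linearZ /= vec_mxK.
have nzX: X != 0 by rewrite vec_mx_eq0.
have Xg: X *m rG g = a *: (invmx P *m X).
  by rewrite scalemxAr -PXg !mulmxA mulVmx // mul1mx.
have modX: mxmodule rG X.
  apply: subset_trans sGHg _; rewrite join_subG cycle_subG inE Gg /= Xg.
  rewrite scalemx_sub ?submxMl // andbT; apply/subsetP=> h Hh.
  by rewrite inE (subsetP sHG) //= -Tv // submxMl.
have [_ /(_ <<X>>%MS)] := (mx_irrP rG).1 irrG.
rewrite (eqmx_module _ (genmxE X)) (eqmx_eq0 (genmxE X)) => /(_ modX nzX).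
rewrite /row_full genmxE => /eqP fullX; apply/eqP; rewrite eqn_leq rank_leq_col.
by rewrite -[X in (X <= _)%N]fullX rank_leq_row.
Qed.

(** Take [g] outside [H]. If [g] stabilizes the homogeneous component of [M], then [H] and [g]
    generate [G] and [M] is the whole module. Otherwise the stabilizer is [H], so there are
    [#|G : H|] components, each of rank at least [\rank M]; as the translates of [M] span, equality
    holds. *)
Lemma dvdn_Clifford_prime_index M :
  prime #|G : H| -> mxsimple rH M -> (n %| #|G : H| * \rank M)%N.
Proof.
move=> pr_GH simM; have [modM nzM _] := simM.
have maxH (K : {group gT}) : H \subset K -> K \subset G -> K != H -> K = G.
  move=> sHK sKG neKH; apply/eqP; rewrite -val_eqE /= eqEsubset sKG -indexg_eq1.
  have [_ pr_dvd] := primeP pr_GH; have := pr_dvd #|G : K|.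
  rewrite -(Lagrange_index sKG sHK) dvdn_mulr // => /(_ isT)/orP[// | ].
  rewrite -{1}[#|G : K|]muln1 eqn_pmul2l // eq_sym indexg_eq1 => sKH.
  by case/eqP: neKH; apply/eqP; rewrite -val_eqE /= eqEsubset sKH.
have [g Gg notHg]: exists2 g, g \in G & g \notin H.
  apply/subsetPn; apply: contraL pr_GH => sGH.
  by rewrite (eqP (_ : #|G : H| == 1%N)) // indexg_eq1.
pose sH := DecSocleType rH; pose W : sH := PackSocle (component_socle sH simM).
have defW : W = component_mx rH M :> 'M_n by rewrite PackSocleK.
have sMW : (M <= W)%MS by rewrite defW component_mx_id.
have [Wg | not_Wg] := boolP (g \in rstabs rG W).
  rewrite {1}(@Clifford_homogeneous_cyclic g M) ?dvdn_mull //.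
    have sHgG : H <*> <[g]> \subset G by rewrite join_subG sHG cycle_subG.
    have neH : (H <*> <[g]>)%G != H.
      apply: contraNneq notHg => <-.
      by rewrite (subsetP (joing_subr _ _)) // cycle_id.
    by have /(congr1 (@gval _)) /= -> := maxH _ (joing_subl H <[g]>) sHgG neH.
  apply: component_mx_iso => //; first exact: Clifford_simple.
  rewrite -defW; apply: submx_trans (submxMr _ sMW) _.
  by rewrite inE in Wg; case/andP: Wg.
have defH : rstabs rG W = H.
  have sHW : H \subset rstabs rG W.
    have: mxmodule rH W by apply: component_mx_module.
    by rewrite /mxmodule rstabs_subg subsetI => /andP[].
  apply/eqP/idPn=> neWH.
  have /(congr1 (@gval _)) /= WG := maxH [group of rstabs rG W] sHW (rstabs_sub rG W) neWH.
  by rewrite WG Gg in not_Wg.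
have card_sH : #|sH| = #|G : H|.
  have Wt : W \in [set: sH] by rewrite inE.
  rewrite -cardsT -(atransPin (subxx G) (Clifford_atrans irrG sH) Wt) card_orbit_in //.
  by rewrite Clifford_astab1 defH (setIidPr sHG).
have rn := Clifford_rank_components irrG W; rewrite card_sH in rn.
suffices eqn : (#|G : H| * \rank M)%N = n by rewrite eqn.
apply/eqP; rewrite eqn_leq; apply/andP; split.
  by apply: leq_trans (eq_leq rn); rewrite leq_mul2l (mxrankS sMW) orbT.
have rT : \rank (\sum_(x in G) M *m rG x)%MS = n.
  by rewrite (sum_translates_irr irrG nzM) mxrank1.
exact: leq_trans (eq_leq (esym rT)) (mxrank_sum_translates modM).
Qed.

End CliffordDegrees.

(** Induction on the index, through a normal subgroup [K] of prime index in [G] that contains [H]: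
    the prime case applies to [G] over [K], the induction hypothesis to a simple [K]-submodule. *)
Lemma dvdn_Clifford_solvable (F : closedFieldType) (gT : finGroupType)
    (G H : {group gT}) (nsHG : H <| G) n (rG : mx_representation F G n) (M : 'M_n) :
    solvable (G / H) -> mx_irreducible rG ->
    mxsimple (subg_repr rG (normal_sub nsHG)) M ->
  (n %| #|G : H| * \rank M)%N.
Proof.
have [m] := ubnP #|G : H|; elim: m => // m IHm in G nsHG n rG M *.
move=> leGm solGH irrG simM; have sHG := normal_sub nsHG.
have [GH1 | ntGH] := eqVneq (G / H)%g 1%g.
  have sGH : G \subset H by rewrite -quotient_sub1 ?normal_norm // GH1.
  rewrite (eqP (_ : #|G : H| == 1%N)) ?indexg_eq1 // mul1n.
  have [modM nzM _] := simM; suffices -> : \rank M = n by [].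
  apply/eqP; have [_ /(_ M) fullM] := (mx_irrP rG).1 irrG; apply: fullM nzM.
  apply/mxmoduleP=> x /(subsetP sGH) Hx; exact: (mxmoduleP modM).
have [Kbar nsKG prGK] := sol_prime_factor_exists solGH ntGH.
have [K defK sHK nsK] := inv_quotientN nsHG nsKG.
have nsHK : H <| K := normalS sHK (normal_sub nsK) nsHG.
have iGK : #|G : K| = #|(G / H)%g : Kbar|.
  rewrite defK /=; apply/esym/index_quotient_eq; rewrite ?normal_norm //.
    exact: subset_trans (subsetIr G H) sHK.
  exact: normal_sub.
rewrite -iGK in prGK; pose rK := subg_repr rG (normal_sub nsK).
have [|X simX _] := @dec_mxsimple_exists _ _ _ _ rK 1%:M (mxmodule1 _).
  by case: irrG.
have [modX nzX _] := simX; pose sX := submod_repr modX.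
have irrX : mx_irreducible sX by apply/submod_mx_irr.
have [|M1 simM1 _] := @dec_mxsimple_exists _ _ _ _
    (subg_repr sX (normal_sub nsHK)) 1%:M (mxmodule1 _).
  by case: irrX.
have simM1' : mxsimple (subg_repr rG (normal_sub nsHG)) <<val_submod M1>>%MS.
  have modXH : mxmodule (subg_repr rG (normal_sub nsHG)) X.
    by apply/mxmoduleP=> x /(subsetP sHK); apply: (mxmoduleP modX).
  exact: (@val_submod_simple _ _ _ _ _ _ modXH M1 simM1).
have dvX : (\rank X %| #|K : H| * \rank M1)%N.
  apply: (IHm K nsHK _ sX) => //; last first.
    by apply: solvableS solGH; rewrite quotientS ?normal_sub.
  rewrite -ltnS; apply: leq_trans leGm; rewrite ltnS -(Lagrange_index (normal_sub nsK) sHK).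
  by rewrite ltn_Pmull ?prime_gt1.
(* [M1] was found inside [X] and may differ from [M], but all simple [H]-submodules have the same
   rank. *)
have rM1 : \rank M1 = \rank M.
  rewrite -(Clifford_simple_rank irrG simM1' simM) mxrank_gen.
  by rewrite /val_submod /= mxrankMfree ?row_base_free.
rewrite -(Lagrange_index (normal_sub nsK) sHK) -mulnA -rM1.
apply: dvdn_trans (dvdn_Clifford_prime_index irrG prGK simX) _.
by rewrite dvdn_pmul2l ?prime_gt0.
Qed.

(** * Induced representations *)

Section Transversal.

Variables (gT : finGroupType) (G H : {group gT}).
Hypothesis sHG : H \subset G.

Definition rtrans (i : 'I_#|rcosets H G|) : gT := repr (enum_val i).

Lemma rtrans_in i : rtrans i \in G.
Proof.
rewrite /rtrans; have /rcosetsP[x Gx ->] := enum_valP i.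
by case: repr_rcosetP => h Hh; rewrite groupM // (subsetP sHG).
Qed.

Lemma rcoset_rtrans i : H :* rtrans i = enum_val i.
Proof.
by rewrite /rtrans; have /rcosetsP[x Gx ->] := enum_valP i; rewrite rcoset_repr.
Qed.

Lemma rtrans_surj x : x \in G ->
  exists j, forall k, ((x * (rtrans k)^-1)%g \in H) = (k == j).
Proof.
move=> Gx; have Hx_in : H :* x \in rcosets H G by apply/rcosetsP; exists x.
exists (enum_rank_in Hx_in (H :* x)) => k; rewrite -mem_rcoset rcoset_rtrans.
apply/idP/eqP=> [xk | ->]; last by rewrite enum_rankK_in // rcoset_refl.
apply: (can_inj (enum_valK_in Hx_in)); rewrite enum_rankK_in // -rcoset_rtrans.
by apply/esym/rcoset_eqP; rewrite rcoset_rtrans.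
Qed.

Lemma rtrans_mul i x : x \in G ->
  exists j, forall k, ((rtrans i * x * (rtrans k)^-1)%g \in H) = (k == j).
Proof. by move=> Gx; apply: rtrans_surj; rewrite groupM ?rtrans_in. Qed.

(** [repr] picks 1 from a subgroup, so the coset [H] itself is represented by 1. *)
Lemma rtrans1 : exists2 i, rtrans i = 1%g & forall k, ((rtrans k)^-1 \in H)%g = (k == i).
Proof.
have [i def_i] := rtrans_surj (group1 G); exists i => [|k]; last by rewrite -def_i mul1g.
have := def_i i; rewrite eqxx mul1g groupV => Hi.
by rewrite /rtrans -rcoset_rtrans rcoset_id // repr_group.
Qed.

Lemma rtrans_eq i j : ((rtrans i * (rtrans j)^-1)%g \in H) = (i == j).
Proof.
have [k def_k] := rtrans_surj (rtrans_in i).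
by have := def_k i; rewrite mulgV group1 def_k => /esym/eqP->; rewrite eq_sym.
Qed.

Lemma cfInd_rtrans (phi : 'CF(H)) x :
  'Ind[G] phi x = \sum_i phi (rtrans i * x * (rtrans i)^-1)%g.
Proof.
rewrite cfIndE //; apply: canLR (mulKf (neq0CG H)) _.
rewrite (reindex_inj invg_inj) /= (eq_bigl _ _ (groupV G)).
rewrite (set_partition_big _ (rcosets_partition sHG)) /=.
rewrite big_enum_val mulr_sumr; apply: eq_bigr => i _.
rewrite -rcoset_rtrans -[#|H|](card_rcoset _ (rtrans i)) -sum1_card natr_sum mulr_suml.
apply: eq_bigr => y /rcosetP[h Hh ->]; rewrite mul1r.
rewrite -(cfunJ phi (rtrans i * x * (rtrans i)^-1) (groupVr Hh)); congr (phi _).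
by rewrite !conjgE !invgK !invMg !mulgA.
Qed.

Section InducedMatrix.

Variables (R : nzRingType) (d : nat).
Implicit Type f : gT -> 'M[R]_d.

(** [f] is an arbitrary function: the same block matrix serves for a representation and for an
    entrywise lift of it to the algebraic integers, which need not be multiplicative. *)
Definition ind_mx f (x : gT) : 'M_(\sum_(i < #|rcosets H G|) d) :=
  \mxblock_(i, j) (if (rtrans i * x * (rtrans j)^-1)%g \in H
                   then f (rtrans i * x * (rtrans j)^-1)%g else 0).

Lemma mxtrace_ind_mx f x :
  \tr (ind_mx f x) = \sum_i (if (rtrans i * x * (rtrans i)^-1)%g \in H
                             then \tr (f (rtrans i * x * (rtrans i)^-1)%g) else 0).
Proof.
rewrite mxtrace_mxblock; apply: eq_bigr => i _.
by case: ifP => // _; rewrite mxtrace0.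
Qed.

(** For [x] in [G] each block row has at most one nonzero block, in the column of the coset to which
    [x] moves its own. As [f] need not be multiplicative, only two facts are kept for powers: the
    support, and the diagonal blocks at the cosets fixed by [x]. *)
Lemma ind_mx_exprS f x k : x \in G ->
  exists2 B, ind_mx f x ^+ k.+1 = \mxblock_(i, j) B i j
  & forall i,
      (forall j, (rtrans i * x ^+ k.+1 * (rtrans j)^-1)%g \notin H -> B i j = 0)
      /\ ((rtrans i * x * (rtrans i)^-1)%g \in H ->
          B i i = f (rtrans i * x * (rtrans i)^-1)%g ^+ k.+1).
Proof.
move=> Gx; elim: k => [|k [B IHk defB]].
  eexists; first by rewrite expr1 /ind_mx.
  by move=> i; split=> [j | Hi] /=; [rewrite expg1 => /negPf-> | rewrite expr1 Hi].
eexists; first by rewrite exprS IHk; apply: mul_mxblock.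
move=> i; lazy beta; have [j0 def_j0] := rtrans_mul i Gx.
have Hj0 : (rtrans i * x * (rtrans j0)^-1)%g \in H by rewrite def_j0.
have sumE j : \sum_j1 (if (rtrans i * x * (rtrans j1)^-1)%g \in H
    then f (rtrans i * x * (rtrans j1)^-1)%g else 0) *m B j1 j
    = f (rtrans i * x * (rtrans j0)^-1)%g *m B j0 j.
  rewrite (bigD1 j0) //= Hj0 big1 ?addr0 // => j1 /negPf neq_j1.
  by rewrite def_j0 neq_j1 mul0mx.
split=> [j notHj | Hi]; rewrite sumE.
  have [B0 _] := defB j0; rewrite B0 ?mulmx0 //.
  by apply: contra notHj => /(groupM Hj0); rewrite (expgS x k.+1) !mulgA mulgKV.
have -> : j0 = i by apply/eqP; rewrite eq_sym -def_j0.
by have [_ ->] := defB i; rewrite // exprS.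
Qed.

(** Since the power of [x] equals [x], a coset moved by [x] is moved by the power too, and its
    diagonal block vanishes. *)
Lemma mxtrace_ind_mx_exprS f x k : x \in G -> (x ^+ k.+1 = x)%g ->
  \tr (ind_mx f x ^+ k.+1) =
    \sum_i (if (rtrans i * x * (rtrans i)^-1)%g \in H
            then \tr (f (rtrans i * x * (rtrans i)^-1)%g ^+ k.+1) else 0).
Proof.
move=> Gx xk; have [B -> defB] := ind_mx_exprS f k Gx.
rewrite mxtrace_mxblock; apply: eq_bigr => i _; have [B0 Bii] := defB i.
by case: ifPn => [/Bii-> // | ]; rewrite -{1}xk => /B0->; rewrite mxtrace0.
Qed.

End InducedMatrix.

End Transversal.

Section InducedRepr.

Variables (F : fieldType) (gT : finGroupType) (G H : {group gT}).
Hypothesis sHG : H \subset G.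
Variables (d : nat) (rH : mx_representation F H d).

Lemma ind_mx_is_repr : mx_repr G (ind_mx G H rH).
Proof.
split=> [|x y Gx Gy].
  apply/mxblockP=> i j; rewrite mxblockK mulg1 rtrans_eq //.
  apply/matrixP=> k l; rewrite !mxE -[tagnat.Rank _ _ == _]val_eqE /= tagnat.eq_Rank.
  case: eqP => [-> | _]; last by rewrite mxE.
  by rewrite mulgV repr_mx1 mxE -val_eqE.
rewrite mul_mxblock; apply: eq_mxblock => i k.
have [j def_j] := rtrans_mul sHG i Gx.
have Hj : (rtrans i * x * (rtrans j)^-1)%g \in H by rewrite def_j.
rewrite (bigD1 j) //= Hj big1 ?addr0 => [|j1 /negPf neq_j1]; last first.
  by rewrite def_j neq_j1 mul0mx.
have -> : (rtrans i * (x * y) * (rtrans k)^-1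
           = rtrans i * x * (rtrans j)^-1 * (rtrans j * y * (rtrans k)^-1))%g.
  by rewrite !mulgA mulgKV.
rewrite groupMl //; case: ifP => Hk; last by rewrite mulmx0.
by rewrite repr_mxM.
Qed.

Definition ind_repr := MxRepresentation ind_mx_is_repr.

(** [E] is the block of the isomorphism at the coset [H]; by equivariance the other blocks are its
    translates. With the converse below, being induced is tested inside the module: an
    [H]-homomorphism with spanning translates, and a dimension equation. *)
Lemma mx_rsim_ind_hom n (rG : mx_representation F G n) :
    mx_rsim ind_repr rG ->
  exists E : 'M_(d, n),
    [/\ forall h, h \in H -> rH h *m E = E *m rG h, n = (#|G : H| * d)%N
      & (1%:M <= \sum_(x in G) <<E *m rG x>>)%MS].
Proof.
case=> B dimB freeB homB; pose E i := submxcol B i.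
have defB : B = \mxcol_i E i by rewrite submxcolK.
have dim_n : n = (#|G : H| * d)%N by rewrite -dimB sum_nat_const card_ord.
have EJ i j x : x \in G -> (rtrans i * x * (rtrans j)^-1)%g \in H ->
  E i *m rG x = rH (rtrans i * x * (rtrans j)^-1)%g *m E j.
- move=> Gx Hij; have /(congr1 (fun C => submxcol C i)) := homB x Gx.
  rewrite {1}defB /= /ind_mx mul_mxblock_mxrow mxcolK -submxcol_mul => <-.
  have [k def_k] := rtrans_mul sHG i Gx; rewrite (bigD1 j) //= Hij big1 ?addr0 //.
  move=> j1 neq_j1; rewrite def_k; case: eqP => [eq_j1k | _]; last by rewrite mul0mx.
  by rewrite eq_j1k eq_sym -def_k Hij in neq_j1.
have [i0 ti0 def_i0] := rtrans1 G H.
exists (E i0); split=> // [h Hh|].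
  by have := EJ i0 i0 h (subsetP sHG h Hh); rewrite !ti0 mul1g invg1 mulg1 => ->.
have fullB : row_full B by rewrite /row_full (eqnP freeB) dimB.
rewrite -(sub1mx B) in fullB; apply: submx_trans fullB _.
apply/row_subP=> s; rewrite defB row_mxcol; set j := tagnat.sig1 s.
apply: submx_trans (row_sub _ _) _.
have := EJ i0 j _ (rtrans_in sHG j).
rewrite !ti0 mul1g mulgV repr_mx1 mul1mx group1 => /(_ isT) def_Ej.
by rewrite (sumsmx_sup (rtrans j)) ?(rtrans_in sHG) // genmxE def_Ej.
Qed.

(** The translates of [E] along the transversal, stacked, have full rank because they span, and form
    a square matrix by the dimension equation. *)
Lemma hom_mx_rsim_ind n (rG : mx_representation F G n) (E : 'M_(d, n)) :
    (forall h, h \in H -> rH h *m E = E *m rG h) -> n = (#|G : H| * d)%N ->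
    (1%:M <= \sum_(x in G) <<E *m rG x>>)%MS ->
  mx_rsim ind_repr rG.
Proof.
move=> homE dim_n fullE; pose B := \mxcol_(i < #|rcosets H G|) (E *m rG (rtrans i)).
have dimB : (\sum_(i < #|rcosets H G|) d)%N = n.
  by rewrite sum_nat_const card_ord dim_n.
have fullB : row_full B.
  rewrite -sub1mx; apply: submx_trans fullE _; apply/sumsmx_subP=> x Gx.
  have [j def_j] := rtrans_surj H Gx.
  have Hj : (x * (rtrans j)^-1)%g \in H by rewrite def_j.
  rewrite genmxE -[x](mulgKV (rtrans j)) repr_mxM ?(rtrans_in sHG) ?(subsetP sHG _ Hj) //.
  rewrite mulmxA -homE // -mulmxA; apply: submx_trans (submxMl _ _) _.
  by rewrite -[E *m _](mxcolK (fun i => E *m rG (rtrans i))) rowsub_sub.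
exists B => // [|x Gx].
  by rewrite /row_free (eqnP fullB) dimB.
rewrite /B /= /ind_mx mul_mxblock_mxrow mxcol_mul; apply: eq_mxcol => i.
have [j def_j] := rtrans_mul sHG i Gx.
have Hj : (rtrans i * x * (rtrans j)^-1)%g \in H by rewrite def_j.
rewrite (bigD1 j) //= Hj big1 ?addr0 => [|j1 /negPf neq_j1]; last first.
  by rewrite def_j neq_j1 mul0mx.
rewrite mulmxA homE // -!mulmxA -!repr_mxM ?(rtrans_in sHG) ?(subsetP sHG _ Hj) //.
by rewrite mulgKV.
Qed.

End InducedRepr.

(** * Pseudo-monomial representations and solvability *)

(** The kernel of [E] is a submodule, as in Schur's lemma. [r] is a bare function so that it can be
    a representation of a larger group. *)
Lemma irr_hom_row_free (F : fieldType) (gT : finGroupType) (H : {group gT}) m n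
    (rH : mx_representation F H m) (r : gT -> 'M[F]_n) (E : 'M_(m, n)) :
    mx_irreducible rH -> (forall h, h \in H -> rH h *m E = E *m r h) -> E != 0 ->
  row_free E.
Proof.
move=> /mx_irrP[_ irrH] homE; apply: contraNT => not_freeE.
have /(irrH (kermx E)) : mxmodule rH (kermx E).
  apply/mxmoduleP=> h Hh; apply/sub_kermxP.
  by rewrite -mulmxA homE // mulmxA mulmx_ker mul0mx.
rewrite kermx_eq0 not_freeE -sub1mx => /(_ isT)/sub_kermxP.
by rewrite mul1mx => ->.
Qed.

(** * Simple modules along embeddings equivariant up to a map of groups *)

Section TwistedHom.

Variables (F : fieldType) (gT : finGroupType) (K1 K2 : {group gT}) (m n : nat).
Variables (r1 : mx_representation F K1 m) (r2 : mx_representation F K2 n).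
Variables (phi : gT -> gT) (A : 'M[F]_(m, n)).
Hypothesis freeA : row_free A.
Hypothesis phi_hom : forall z, z \in K1 -> phi z \in K2 /\ r1 z *m A = A *m r2 (phi z).
Hypothesis phi_onto : forall y, y \in K2 -> exists2 z, z \in K1 & y = phi z.

Lemma twisted_hom_module k (U : 'M_(k, m)) : mxmodule r2 (U *m A) = mxmodule r1 U.
Proof.
apply/mxmoduleP/mxmoduleP => [modU z K1z | modU y /phi_onto[z K1z ->]];
  have [K2z homA] := phi_hom K1z.
  by rewrite -(submxMfree _ _ freeA) -mulmxA homA mulmxA modU.
by rewrite -mulmxA -homA mulmxA submxMr // modU.
Qed.

(** Used with [phi] the identity, to view a submodule inside a larger module, and with [phi] a
    conjugation, to pass to a conjugate subgroup. *)
Lemma twisted_hom_simple W : mxsimple r1 W <-> mxsimple r2 <<W *m A>>%MS.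
Proof.
have genA k (U : 'M_(k, n)) : mxmodule r2 <<U>>%MS = mxmodule r2 U.
  exact: eqmx_module (genmxE _).
have A_eq0 k (U : 'M_(k, m)) : (U *m A == 0) = (U == 0) by rewrite mulmx_free_eq0.
split=> [[modW nzW simW] | [modW nzW simW]]; split=> //.
- by rewrite genA twisted_hom_module.
- by rewrite (eqmx_eq0 (genmxE _)) A_eq0.
- move=> V modV; rewrite !genmxE => sVWA nzV.
  have [D0 defV] := submxP sVWA; rewrite mulmxA in defV.
  set D := D0 *m W in defV.
  suffices: (W <= <<D>>)%MS by rewrite genmxE defV => /submxMr->.
  apply: simW.
  + by rewrite (eqmx_module _ (genmxE _)) -twisted_hom_module -defV.
  + by rewrite genmxE -(submxMfree _ _ freeA) -defV.
  by rewrite (eqmx_eq0 (genmxE _)) -A_eq0 -defV.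
- by rewrite genA twisted_hom_module in modW.
- by rewrite (eqmx_eq0 (genmxE _)) A_eq0 in nzW.
move=> V modV sVW nzV; suffices: (<<W *m A>> <= <<V *m A>>)%MS by rewrite !genmxE submxMfree.
apply: simW; first by rewrite genA twisted_hom_module.
  by rewrite !genmxE submxMr.
by rewrite (eqmx_eq0 (genmxE _)) A_eq0.
Qed.

End TwistedHom.

(** Module counterpart of both [char_degrees] and [Brauer_degrees], to which the two parts are
    reduced. *)
Definition induced_degree (F : fieldType) (gT : finGroupType) (G : {group gT}) n
    (rG : mx_representation F G n) (d : nat) : Prop :=
  exists (H : {group gT}) (sHG : H \subset G) (rH : mx_representation F H d),
    mx_irreducible rH /\ mx_rsim (ind_repr sHG rH) rG.

Definition pseudo_monomial_repr (F : fieldType) (gT : finGroupType) (G : {group gT}) n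
    (rG : mx_representation F G n) : Prop :=
  forall k, (forall d, induced_degree rG d -> (k %| d)%N) -> (k %| 1)%N.

Lemma induced_degree_simple (F : fieldType) (gT : finGroupType) (G H : {group gT})
    (sHG : H \subset G) n (rG : mx_representation F G n) (U : 'M_n) :
    mxsimple (subg_repr rG sHG) U -> n = (#|G : H| * \rank U)%N ->
    (1%:M <= \sum_(x in G) U *m rG x)%MS ->
  induced_degree rG (\rank U).
Proof.
move=> simU dim_n fullU; have [modU _ _] := simU.
exists H, sHG, (submod_repr modU); split; first exact/submod_mx_irr.
apply: hom_mx_rsim_ind (row_base U) _ dim_n _ => [h Hh|].
  have := val_submodJ modU 1%:M Hh.
  by rewrite /val_submod /= !mul1mx.
apply: submx_trans fullU _; apply/sumsmx_subP=> x Gx.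
by rewrite (sumsmx_sup x) // genmxE (eqmxMr _ (eq_row_base U)).
Qed.

(** * Perfect subgroups acting trivially, and solvability *)

Section Perfect.

Variables (F : fieldType) (gT : finGroupType) (G S : {group gT}).
Hypotheses (sSG : S \subset G) (perfS : S \subset S^`(1)%g).

(** For [x] and [y] in [S] the operators satisfy [(x - 1)(y - 1) = 0], that is [x y = x + y - 1]. So
    they commute, all commutators act trivially, and these generate [S]. *)
Lemma perfect_sub_rker_ext n (rG : mx_representation F G n) (U : 'M_n)
    (modU : mxmodule rG U) :
    S \subset rker (submod_repr modU) -> S \subset rker (factmod_repr modU) ->
  S \subset rker rG.
Proof.
rewrite rker_submod => /subsetP cSU /subsetP cSU'.
have subU x : x \in S -> (rG x - 1%:M <= U)%MS.
  move=> Sx; have Gx := subsetP sSG x Sx.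
  have /rkerP[_ defx] := cSU' x Sx.
  rewrite -in_factmod_eq0 linearB /= -[rG x]mul1mx (in_factmodJ modU) //.
  by rewrite defx mulmx1 subrr.
have sub_comm x y : x \in S -> y \in S -> (rG x - 1%:M) *m (rG y - 1%:M) = 0.
  move=> Sx Sy; have [D ->] := submxP (subU x Sx).
  by rewrite -mulmxA mulmxBr mulmx1 (rstab_act (cSU y Sy)) // subrr mulmx0.
have defM x y : x \in S -> y \in S -> rG x *m rG y = rG x + rG y - 1%:M.
  move=> Sx Sy; have /eqP := sub_comm x y Sx Sy.
  rewrite mulmxBr mulmxBl mulmx1 mul1mx subr_eq0 => /eqP/(canRL (subrK _)) ->.
  by rewrite addrAC.
apply: subset_trans perfS _; rewrite gen_subG; apply/subsetP=> _ /imset2P[x y Sx Sy ->].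
have Gx := subsetP sSG x Sx; have Gy := subsetP sSG y Sy.
apply/rkerP; split; first by rewrite groupR.
have comm_xy : rG (x * y)%g = rG (y * x)%g.
  by rewrite !repr_mxM // !defM // (addrC (rG x)).
rewrite commgEl conjgE mulgA -invMg repr_mxM ?groupV ?groupM // comm_xy.
by rewrite -repr_mxM ?groupV ?groupM // mulVg repr_mx1.
Qed.

End Perfect.

Section Solvable.

Variables (F : closedFieldType) (gT : finGroupType) (G S : {group gT}).
Hypotheses (nsSG : S <| G) (perfS : S \subset S^`(1)%g).
Let sSG := normal_sub nsSG.

Let irr_le m := forall n (rG : mx_representation F G n),
  mx_irreducible rG -> (n < m)%N -> S \subset rker rG.

(** Passage from irreducible to arbitrary modules of degree below [m], by splitting off a simple
    submodule and using the extension lemma for perfect groups. *)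
Lemma perfect_sub_rker_lt m : irr_le m ->
  forall n (rG : mx_representation F G n), (n < m)%N -> S \subset rker rG.
Proof.
move=> irr_m n; have [k] := ubnP n; elim: k n => // k IHk n lenk rG ltnm.
have [n0 | nzn] := posnP n.
  apply/subsetP=> x Sx; apply/rkerP; split; first exact: (subsetP sSG).
  by apply/matrixP=> i; have := ltn_ord i; rewrite {2}n0.
have nz1 : 1%:M != 0 :> 'M[F]_n by rewrite -mxrank_eq0 mxrank1 -lt0n.
have [U simU _] := dec_mxsimple_exists (mxmodule1 rG) nz1.
have [modU nzU minU] := simU.
have [fullU | not_fullU] := boolP (row_full U).
  apply: irr_m => //; split; rewrite ?mxmodule1 // => V modV _ nzV.
  have sVU : (V <= U)%MS by apply: submx_full.
  by apply: submx_trans (minU V modV sVU nzV); rewrite sub1mx.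
have ltUn : (\rank U < n)%N by rewrite ltn_neqAle rank_leq_col andbT.
apply: (perfect_sub_rker_ext sSG perfS (modU := modU)); apply: IHk.
- exact: leq_trans ltUn _.
- exact: ltn_trans ltUn _.
- by rewrite mxrank_coker (leq_trans _ (lenk : n <= k)%N) // ltn_subrL lt0n mxrank_eq0 nzU.
by rewrite mxrank_coker (leq_ltn_trans (leq_subr _ _)).
Qed.

(** The all-one vector [u] spans a fixed line of the permutation module on the cosets of [H]. The
    line and its quotient both have dimension below [n], so [S] acts trivially on the permutation
    module and fixes the coset [H]. *)
Lemma perfect_sub_of_ind n (H : {group gT}) : H \subset G ->
  irr_le n -> (#|G : H| <= n)%N -> S \subset H.
Proof.
move=> sHG irr_n le_n; have [-> // | neHG] := eqVneq H G.
have r1P : mx_repr H (fun _ : gT => 1%:M : 'M[F]_1).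
  by split=> // x y _ _; rewrite mulmx1.
pose r1 := MxRepresentation r1P; pose P := ind_repr sHG r1.
have dimP : (\sum_(i < #|rcosets H G|) 1)%N = #|G : H|.
  by rewrite sum_nat_const card_ord muln1.
pose u : 'rV[F]_(\sum_(i < #|rcosets H G|) 1) := const_mx 1.
have uP x : x \in G -> u *m P x = u.
  move=> Gx; rewrite /u -(mxrow_const (q_ := fun _ : 'I__ => 1%N)) /P /= /ind_mx.
  rewrite mul_mxrow_mxblock; apply: eq_mxrow => j.
  have [i def_i] := rtrans_mul sHG j (groupVr Gx).
  have inH k : (rtrans k * x * (rtrans j)^-1)%g \in H = (k == i).
    by rewrite -def_i -groupV !invMg invgK mulgA.
  rewrite (bigD1 i) //= inH eqxx mulmx1 big1 ?addr0 // => k /negPf neq_ki.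
  by rewrite inH neq_ki mulmx0.
have modu : mxmodule P <<u>>%MS.
  by rewrite (eqmx_module _ (genmxE _)); apply/mxmoduleP=> x Gx; rewrite uP.
have iGH : (1 < #|G : H|)%N.
  rewrite ltn_neqAle eq_sym indexg_eq1 indexg_gt0 andbT.
  by apply: contra neHG => sGH; rewrite -val_eqE eqEsubset sHG.
have rank_u : \rank <<u>>%MS = 1%N.
  rewrite mxrank_gen rank_rV; case: eqP => // u0.
  have i0 : 'I_(\sum_(i < #|rcosets H G|) 1).
    by rewrite dimP; exact: Ordinal (ltnW iGH).
  by have /rowP/(_ i0)/eqP := u0; rewrite !mxE oner_eq0.
have sSP : S \subset rker P.
  apply: (perfect_sub_rker_ext sSG perfS (modU := modu));
    apply: perfect_sub_rker_lt irr_n _ _ _.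
    by rewrite rank_u (leq_trans iGH).
  by rewrite mxrank_coker rank_u dimP subn1 prednK // ltnW.
have [i0 ti0 _] := rtrans1 G H.
apply/subsetP=> x Sx; have /rkerP[Gx /(congr1 (fun B => submxblock B i0 i0))] := subsetP sSP x Sx.
rewrite /P /= /ind_mx mxblockK ti0 mul1g invg1 mulg1; case: ifP => // _.
move/matrixP/(_ 0 0)/eqP; rewrite !mxE eqxx eq_sym.
by rewrite oner_eq0.
Qed.

Lemma pseudo_monomial_sub_rker :
    (forall n (rG : mx_representation F G n),
       mx_irreducible rG -> pseudo_monomial_repr rG) ->
  forall m, irr_le m.
Proof.
move=> pmG; elim=> [|m IHm] n rG irrG //; rewrite ltnS leq_eqVlt => /predU1P[def_n | /IHm-> //].
rewrite -{}def_n in IHm; pose rS := subg_repr rG sSG.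
have [_ nz1 _] := irrG.
have [W simW _] := dec_mxsimple_exists (mxmodule1 rS) nz1.
have [modW nzW _] := simW.
have /eqP rW1 : \rank W == 1%N.
  rewrite -dvdn1; apply: (pmG _ _ irrG) => d [H [sHG [rH [irrH simH]]]].
  have [E [homE dim_n fullE]] := mx_rsim_ind_hom simH.
  have d_gt0 : (0 < d)%N by have [] := (mx_irrP rH).1 irrH.
  have sSH : S \subset H.
    by apply: perfect_sub_of_ind IHm _; rewrite // dim_n leq_pmulr.
  have nsSH : S <| H := normalS sSH sHG nsSG.
  have nzE : E != 0.
    apply: contraNneq nz1 => E0; rewrite -submx0; apply: submx_trans fullE _.
    by apply/sumsmx_subP=> x _; rewrite E0 mul0mx genmx0.
  have freeE := irr_hom_row_free irrH homE nzE.
  pose rHS := subg_repr rH (normal_sub nsSH).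
  have [|W1 simW1 _] := dec_mxsimple_exists (mxmodule1 rHS).
    by have [] := irrH.
  have simW1E : mxsimple rS <<W1 *m E>>%MS.
    apply/(twisted_hom_simple freeE (phi := id) _ _ W1); last exact: simW1.
      by move=> z Sz; split=> //; apply: homE; apply: (subsetP sSH).
    by move=> y Sy; exists y.
  rewrite (Clifford_simple_rank irrG simW simW1E) mxrank_gen mxrankMfree //.
  exact: (dvdn_Clifford_simple_rank irrH simW1).
(* The action on a line is abelian, so the perfect group [S] fixes [W]. The fixed points of the
   normal subgroup [S] then form a nonzero [G]-submodule, hence everything. *)
have sSW : S \subset rstab rG W.
  have := rker_linear (submod_repr modW) rW1.
  rewrite rker_submod rstab_subg => /(subset_trans perfS).
  by rewrite subsetI => /andP[].
rewrite /rker (rfix_mx_rstabC _ _ sSG).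
have [_ _ minG] := irrG; apply: minG (normal_rfix_mx_module rG nsSG) (submx1 _) _.
apply: contraNneq nzW => fix0; rewrite -submx0 -fix0.
by rewrite -rfix_mx_rstabC.
Qed.

End Solvable.

(** A perfect subgroup [S0] is replaced by its normal closure [S], which is again perfect: its
    derived subgroup is normalized by [G] and contains [S0]. Then [S] acts trivially on the regular
    module, which is faithful. *)
Lemma pseudo_monomial_solvable (F : closedFieldType) (gT : finGroupType) (G : {group gT}) :
    (forall n (rG : mx_representation F G n),
       mx_irreducible rG -> pseudo_monomial_repr rG) ->
  solvable G.
Proof.
move=> pmG; apply/forall_inP=> S0; rewrite subsetI => /andP[sS0G perfS0].
pose S := <<class_support S0 G>>%G.
have nsSG : S <| G.
  rewrite /normal gen_subG class_support_sub_norm ?normG //=.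
  by rewrite norms_gen // class_support_norm.
have sS0S : S0 \subset S.
  by apply: subset_trans (subset_gen _); apply: sub_class_support.
have perfS : S \subset S^`(1)%g.
  rewrite gen_subG class_support_sub_norm //.
    by apply: subset_trans perfS0 _; apply: commgSS.
  exact: char_norm_trans (der_char 1 S) (normal_norm nsSG).
have irrS := @pseudo_monomial_sub_rker _ _ _ _ nsSG perfS pmG #|G|.+1.
have sSker := @perfect_sub_rker_lt _ _ _ _ nsSG perfS _ irrS _ (regular_repr F G) (ltnSn _).
have S1 := subset_trans sSker (regular_mx_faithful F G).
by rewrite -subG1 (subset_trans sS0S).
Qed.

(** * Normal Hall subgroups *)

(** Clifford theory over the trivial subgroup, whose simple modules are lines; this works in every
    characteristic. *)
Lemma dvdn_irr_solvable_degree (F : closedFieldType) (gT : finGroupType)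
    (G : {group gT}) n (rG : mx_representation F G n) :
  solvable G -> mx_irreducible rG -> (n %| #|G|)%N.
Proof.
move=> solG irrG; have ns1G := normal1 G.
have [|M simM _] := dec_mxsimple_exists (mxmodule1 (subg_repr rG (normal_sub ns1G))).
  by case: irrG.
have := dvdn_Clifford_solvable (quotient_sol 1 solG) irrG simM.
have closF := @group_closure_closed_field F gT.
by rewrite (mxsimple_abelian_linear (closF _) (abelian1 gT) simM) muln1 indexg1.
Qed.

(** An irreducible quotient of the induced module is reached by factoring out simple submodules. The
    translates of the image of [E] keep spanning, so that image never becomes 0. *)
Lemma irr_over_exists (F : closedFieldType) (gT : finGroupType) (G N : {group gT})
    (sNG : N \subset G) m (rN : mx_representation F N m) :
    mx_irreducible rN ->
  exists n (rG : mx_representation F G n) (E : 'M_(m, n)),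
    [/\ mx_irreducible rG, forall x, x \in N -> rN x *m E = E *m rG x & E != 0].
Proof.
move=> irrN; have [E [homE dim_n fullE]] := mx_rsim_ind_hom (mx_rsim_refl (ind_repr sNG rN)).
have m_gt0 : (0 < m)%N by have [] := (mx_irrP rN).1 irrN.
have : (0 < \sum_(i < #|rcosets N G|) m)%N by rewrite dim_n muln_gt0 indexg_gt0.
move: (ind_repr sNG rN) E homE fullE; move: (\sum_(i < _) m)%N {dim_n} => n.
have [k] := ubnP n; elim: k n => // k IHk n lenk rG E homE fullE n_gt0.
have nz1 : 1%:M != 0 :> 'M[F]_n by rewrite -mxrank_eq0 mxrank1 -lt0n.
have [U simU _] := dec_mxsimple_exists (mxmodule1 rG) nz1.
have [modU nzU minU] := simU.
have [fullU | not_fullU] := boolP (row_full U).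
  exists n, rG, E; split=> //.
    split; rewrite ?mxmodule1 // => V modV _ nzV.
    have sVU : (V <= U)%MS by apply: submx_full.
    by apply: submx_trans (minU V modV sVU nzV); rewrite sub1mx.
  apply: contraNneq nz1 => E0; rewrite -submx0; apply: submx_trans fullE _.
  by apply/sumsmx_subP=> x _; rewrite E0 mul0mx genmx0.
have ltUn : (\rank U < n)%N by rewrite ltn_neqAle rank_leq_col andbT.
apply: (IHk _ _ (factmod_repr modU) (in_factmod U E)).
- by rewrite mxrank_coker (leq_trans _ (lenk : n <= k)%N) // ltn_subrL lt0n mxrank_eq0 nzU.
- move=> x Nx; rewrite -(in_factmodJ modU) ?(subsetP sNG) // -homE //.
  by rewrite [RHS]in_factmodE -mulmxA -in_factmodE.
- rewrite -[1%:M]val_factmodK; apply: submx_trans (_ : _ <= in_factmod U 1%:M)%MS _.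
    by rewrite in_factmodE submxMl.
  rewrite -[in_factmod U 1%:M]mul1mx.
  apply: submx_trans (submxMr (in_factmod U 1%:M) fullE) _; rewrite sumsmxMr_gen.
  apply/sumsmx_subP=> x Gx; rewrite (sumsmx_sup x) // !genmxE.
  by rewrite (eqmxMr _ (genmxE _)) -in_factmodE (in_factmodJ modU).
by rewrite mxrank_coker subn_gt0.
Qed.

Section Hall.

Variables (F : closedFieldType) (gT : finGroupType) (G N : {group gT}).
Hypotheses (nsNG : N <| G) (hallN : Hall G N) (solG : solvable G).
Let sNG := normal_sub nsNG.
Variables (n : nat) (rG : mx_representation F G n).
Hypothesis irrG : mx_irreducible rG.
Let rGN := subg_repr rG sNG.

(** The restriction to [N] is semisimple, so [Y] is a direct sum of simple modules, all of the same
    rank. *)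
Lemma dvdn_simple_rank_module M (Y : 'M_n) :
  mxsimple rGN M -> mxmodule rGN Y -> (\rank M %| \rank Y)%N.
Proof.
move=> simM modY; have [X /subsetP sXG [def1 _]] := Clifford_basis irrG simM.
have ssim1 : mxsemisimple rGN 1%:M.
  by apply: intro_mxsemisimple def1 _ => x Xx _; apply: Clifford_simple simM (sXG x Xx).
have [I W /= simW defY dxW] := mxsemisimpleS modY (submx1 _) ssim1.
rewrite -defY (mxdirectP dxW) /= dvdn_sum // => i _.
by rewrite (Clifford_simple_rank irrG simM (simW i)).
Qed.

(* The module [Y] has length [k] over [N], where [k] divides [|N|] and [|G : N|]. *)
Lemma Hall_translates_simple (H : {group gT}) d (rH : mx_representation F H d)
    (E : 'M_(d, n)) (nsMH : H :&: N <| H) (W : 'M_d) (T : 'M_n)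
    (Y := (\sum_(x in N) <<W *m E>> *m rG x)%MS) :
    H \subset G -> mx_irreducible rH ->
    (forall h, h \in H -> rH h *m E = E *m rG h) -> n = (#|G : H| * d)%N ->
    (1%:M <= \sum_(x in G) <<E *m rG x>>)%MS ->
    mxsimple (subg_repr rH (normal_sub nsMH)) W -> mxsimple rGN T ->
  mxsimple rGN Y /\ \rank Y = (#|N : H :&: N| * \rank W)%N.
Proof.
move=> sHG irrH homE dim_n fullE simW simT.
have sMN : H :&: N \subset N := subsetIr H N.
have sMG : H :&: N \subset G := subset_trans sMN sNG.
have [modW nzW _] := simW; have [_ nz1 _] := irrG.
have nzE : E != 0.
  apply: contraNneq nz1 => E0; rewrite -submx0; apply: submx_trans fullE _.
  by apply/sumsmx_subP=> x _; rewrite E0 mul0mx genmx0.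
have freeE := irr_hom_row_free irrH homE nzE.
have rWE : \rank <<W *m E>>%MS = \rank W by rewrite mxrank_gen mxrankMfree.
have modWE : mxmodule (subg_repr (subg_repr rG sNG) sMN) <<W *m E>>%MS.
  rewrite (eqmx_module _ (genmxE _)); apply/mxmoduleP=> x Mx.
  have [Hx _] := setIP Mx.
  by rewrite /= -mulmxA -homE // mulmxA submxMr // (mxmoduleP modW).
have modY : mxmodule rGN Y := @sum_translates_module _ _ _ _ rGN <<W *m E>>%MS.
have sWY : (<<W *m E>> <= Y)%MS.
  by rewrite (sumsmx_sup 1%g) // repr_mx1 mulmx1.
have leY : (\rank Y <= #|N : H :&: N| * \rank W)%N.
  by have := mxrank_sum_translates modWE; rewrite rWE.
have [X sXH [defX dxX]] := Clifford_basis irrH simW.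
have dim_d : d = (#|X| * \rank W)%N.
  have rX : \rank (\sum_(x in X) W *m rH x)%MS = d by rewrite defX mxrank1.
  rewrite -{1}rX (mxdirectP dxX) /= -sum_nat_const; apply: eq_bigr => x Xx.
  by rewrite mxrankMfree ?repr_mx_free ?(subsetP sXH).
pose HN := (H <*> N)%G; have sHNG : HN \subset G by rewrite join_subG sHG.
have nNH : H \subset 'N(N) := subset_trans sHG (normal_norm nsNG).
pose rHN := subg_repr rG sHNG.
(* [Z] is an [N]-module containing the image of [E], hence also the [HN]-module [Z0] generated by
   that image. This bounds the rank of [Z0], and so [n], in terms of the rank of [Y]. *)
pose Z := (\sum_(x in X) Y *m rG x)%MS.
have modZ : mxmodule rGN Z.
  apply/mxmoduleP=> y Ny; rewrite sumsmxMr; apply/sumsmx_subP=> x Xx.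
  have Hx := subsetP sXH x Xx; have Gx := subsetP sHG x Hx; have Gy := subsetP sNG y Ny.
  rewrite (sumsmx_sup x) // /= -mulmxA -repr_mxM // conjgCV repr_mxM ?groupJ ?groupV //.
  rewrite mulmxA submxMr // (mxmoduleP modY) // memJ_norm // groupV.
  exact: (subsetP nNH).
have sEZ : (E <= Z)%MS.
  rewrite -[E]mul1mx; apply: submx_trans (submxMr E _) _; first by rewrite -defX.
  rewrite sumsmxMr_gen; apply/sumsmx_subP=> x Xx.
  rewrite (sumsmx_sup x) // genmxE -mulmxA homE ?(subsetP sXH) // mulmxA submxMr //.
  by apply: submx_trans sWY; rewrite genmxE.
pose Z0 := (\sum_(x in HN) <<E>> *m rHN x)%MS.
have sZ0Z : (Z0 <= Z)%MS.
  apply/sumsmx_subP=> x; rewrite /= norm_joinEl // => /mulsgP[h y Hh Ny ->].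
  have [Gh Gy] := (subsetP sHG h Hh, subsetP sNG y Ny).
  rewrite repr_mxM // mulmxA (eqmxMr _ (eqmxMr _ (genmxE E))) -homE //.
  apply: submx_trans (submxMr _ (submxMl _ _)) _.
  exact: submx_trans (submxMr _ sEZ) (mxmoduleP modZ y Ny).
have leZ : (\rank Z <= #|X| * \rank Y)%N.
  apply: leq_trans (mxrank_sum_leqif _).1 _ => /=.
  by rewrite -sum_nat_const leq_sum // => x _; apply: mxrankM_maxl.
have le_n : (n <= #|G : HN| * (#|X| * \rank Y))%N.
  have modZ0 : mxmodule rHN Z0 := @sum_translates_module _ _ _ _ rHN <<E>>%MS.
  have fullZ0 : \rank (\sum_(x in G) Z0 *m rG x)%MS = n.
    apply/eqP; rewrite -[_ == _]/(row_full _) -sub1mx; apply: submx_trans fullE _.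
    apply/sumsmx_subP=> x Gx; rewrite (sumsmx_sup x) // genmxE submxMr //.
    by rewrite (sumsmx_sup 1%g) // repr_mx1 mulmx1 genmxE.
  apply: leq_trans (eq_leq (esym fullZ0)) _.
  apply: leq_trans (mxrank_sum_translates modZ0) _.
  by rewrite leq_mul2l (leq_trans (mxrankS sZ0Z) leZ) orbT.
have iGH : #|G : H| = (#|G : HN| * #|N : H :&: N|)%N.
  rewrite -(Lagrange_index sHNG (joing_subl H N)); congr (_ * _)%N.
  apply/eqP; rewrite -(eqn_pmul2l (cardG_gt0 H)) (Lagrange (joing_subl H N)).
  by rewrite /= norm_joinEl // setIC indexgI LagrangeMl.
have X_gt0 : (0 < #|X|)%N.
  have [d_gt0 _] := (mx_irrP rH).1 irrH.
  by move: d_gt0; rewrite {1}dim_d muln_gt0 => /andP[].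
(* Comparing [n = #|G : H| * #|X| * \rank W] with the upper bound for [n] gives the missing lower
   bound for the rank of [Y]. *)
have rY : \rank Y = (#|N : H :&: N| * \rank W)%N.
  apply/eqP; rewrite eqn_leq leY /=; have := leq_trans (eq_leq (esym dim_n)) le_n.
  rewrite iGH {1}dim_d -mulnA leq_pmul2l ?indexg_gt0 // mulnCA.
  by rewrite leq_pmul2l.
split=> //.
have [k def_k] := dvdnP (dvdn_simple_rank_module simT modY).
have T_gt0 : (0 < \rank T)%N by case: simT => _; rewrite -mxrank_eq0 lt0n.
(* Here [n] is a multiple of [k * \rank T] and divides [#|G : N| * \rank T]. *)
have k_dvd_GN : (k %| #|G : N|)%N.
  have := dvdn_Clifford_solvable (quotient_sol N solG) irrG simT.
  have eq_n : (#|G : HN| * #|X| * k * \rank T)%N = n.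
    rewrite -mulnA -def_k rY; apply: etrans (esym dim_n).
    by rewrite iGH [X in _ = (_ * X)%N]dim_d -!mulnA; congr (_ * _)%N; rewrite mulnCA.
  have dvd_n := dvdn_Clifford_solvable (quotient_sol N solG) irrG simT.
  have := (dvdn_trans (_ : (_ %| n)%N) dvd_n); rewrite -{1}eq_n => /(_ _ (dvdnn _)).
  rewrite dvdn_pmul2r // => /(dvdn_trans _)-> //.
  exact: dvdn_mull.
(* The degree [\rank W] divides the order of the solvable group [H :&: N], so [\rank Y] divides
   [#|N|]. *)
have k_dvd_N : (k %| #|N|)%N.
  apply: dvdn_trans (_ : \rank Y %| _)%N; first by rewrite def_k dvdn_mulr.
  rewrite rY -(Lagrange sMN) mulnC dvdn_pmul2r ?indexg_gt0 //.
  have solM : solvable (H :&: N) := solvableS sMG solG.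
  exact: (dvdn_irr_solvable_degree solM ((submod_mx_irr modW).2 simW)).
have k1 : k = 1%N.
  apply/eqP; rewrite -dvdn1; have [_ /eqP <-] := andP hallN.
  by rewrite dvdn_gcd k_dvd_N.
rewrite k1 mul1n in def_k.
have nzY : Y != 0 by rewrite -mxrank_eq0 def_k -lt0n.
have [M simM sMY] := dec_mxsimple_exists modY nzY.
apply: mx_iso_simple (simM); apply: eqmx_iso; apply/eqmxP.
by rewrite sMY /= -(geq_leqif (mxrank_leqif_sup sMY)) def_k (Clifford_simple_rank irrG simM simT).
Qed.

End Hall.

Theorem pseudo_monomial_repr_Hall (F : closedFieldType) (gT : finGroupType)
    (G N : {group gT}) :
    N <| G -> Hall G N ->
    (forall n (rG : mx_representation F G n),
       mx_irreducible rG -> pseudo_monomial_repr rG) ->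
  forall m (rN : mx_representation F N m),
    mx_irreducible rN -> pseudo_monomial_repr rN.
Proof.
move=> nsNG hallN pmG m rN irrN k dvd_k; have solG := pseudo_monomial_solvable pmG.
pose sNG := normal_sub nsNG.
have [n [rG [E0 [irrG homE0 nzE0]]]] := irr_over_exists sNG irrN.
have freeE0 := irr_hom_row_free irrN homE0 nzE0.
pose rGN := subg_repr rG sNG.
have simT : mxsimple rGN <<1%:M *m E0>>%MS.
  apply/(twisted_hom_simple freeE0 (phi := id) _ _ 1%:M); last exact: irrN.
    by move=> z Nz; split=> //; apply: homE0.
  by move=> y Ny; exists y.
apply: (pmG n rG irrG) => d [H [sHG [rH [irrH simH]]]].
have [E [homE dim_n fullE]] := mx_rsim_ind_hom simH.
have nsMH : H :&: N <| H.
  by rewrite /normal subsetIl normsI ?normG // (subset_trans sHG) ?normal_norm.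
have sMN : H :&: N \subset N := subsetIr H N.
have sMG : H :&: N \subset G := subset_trans sMN sNG.
have [|W simW _] := dec_mxsimple_exists (mxmodule1 (subg_repr rH (normal_sub nsMH))).
  by case: irrH.
apply: dvdn_trans (_ : k %| \rank W)%N (dvdn_Clifford_simple_rank irrH simW).
have [simY rankY] := Hall_translates_simple hallN solG irrG
  sHG irrH homE dim_n fullE simW simT.
set Y := (\sum_(x in N) _)%MS in simY rankY; set W0 := <<W *m E>>%MS in Y simY rankY *.
have nzE : E != 0.
  case: irrG => _ nz1 _; apply: contraNneq nz1 => E0'; rewrite -submx0.
  apply: submx_trans fullE _.
  by apply/sumsmx_subP=> x _; rewrite E0' mul0mx genmx0.
have freeE := irr_hom_row_free irrH homE nzE.
have simW0 : mxsimple (subg_repr rG sMG) W0.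
  apply/(twisted_hom_simple freeE (phi := id) _ _ W); last exact: simW.
    by move=> z /setIP[Hz Nz]; split; [apply/setIP | apply: homE].
  by move=> y My; exists y.
have sW0Y : (W0 <= Y)%MS by rewrite (sumsmx_sup 1%g) // repr_mx1 mulmx1.
(* [Y] is simple over [N], hence isomorphic to a translate of the copy of [rN] in the irreducible
   module above it. *)
have [x Gx [f uf homf defY]] : exists2 x, x \in G & mx_iso rGN (<<1%:M *m E0>> *m rG x)%MS Y.
  have [X /subsetP sXG [def1 _]] := Clifford_basis irrG simT.
  have [||| x Xx isoT] := hom_mxsemisimple_iso (P := mem X)
    (W := fun x => <<1%:M *m E0>>%MS *m rG x) (f := 1%:M) simY.
  - by move=> x Xx _; apply: Clifford_simple simT (sXG x Xx).
  - exact: scalar_mx_hom.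
  - by rewrite mulmx1 def1 submx1.
  by exists x; rewrite ?sXG.
(* [A] maps the module of [rN] onto [Y], with [z] acting on [Y] as its conjugate by [x]. *)
pose A := E0 *m rG x *m f.
have defA : (A :=: Y)%MS.
  apply: eqmx_trans defY; apply/eqmx_sym/eqmxMr/eqmxMr.
  by apply: eqmx_trans (genmxE _) _; rewrite mul1mx.
have freeA : row_free A.
  by rewrite /row_free !mxrankMfree ?row_free_unit ?repr_mx_unit.
have homE0f : (E0 *m rG x <= dom_hom_mx rGN f)%MS.
  by apply: submx_trans homf; rewrite submxMr // genmxE mul1mx.
have nNx : x \in 'N(N) := subsetP (normal_norm nsNG) x Gx.
have homA z : z \in N -> rN z *m A = A *m rG (z ^ x)%g.
  move=> Nz; have Gz := subsetP sNG z Nz; have Nzx : (z ^ x)%g \in N by rewrite memJ_norm.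
  rewrite /A -(hom_mxP homE0f) // !mulmxA homE0 //; congr (_ *m f).
  by rewrite /= -!mulmxA -!repr_mxM ?groupJ // -conjgC.
(* Pulling back along [A] undoes the conjugation: [rN] is induced from the simple [M1]-submodule
   [C], the preimage of [W0], whose rank is that of [W]. *)
pose M1 := ((H :&: N) :^ x^-1)%G.
have sM1N : M1 \subset N by rewrite sub_conjgV (normP nNx).
pose C := <<W0 *m pinvmx A>>%MS.
have defCA : (C *m A :=: W0)%MS.
  by apply: eqmx_trans (eqmxMr _ (genmxE _)) _; rewrite mulmxKpV ?defA.
have rankC : \rank C = \rank W.
  by rewrite -(mxrankMfree _ freeA) defCA mxrank_gen mxrankMfree.
rewrite -rankC; apply: dvd_k; apply: (induced_degree_simple (sHG := sM1N)).
- apply/(twisted_hom_simple (r2 := subg_repr rG sMG) freeA (phi := conjg^~ x) _ _ C).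
  + move=> z; rewrite mem_conjgV => Mzx; split=> //=.
    by apply: homA; have /setIP[_] := Mzx; rewrite memJ_norm.
  + by move=> y My; exists (y ^ x^-1)%g; rewrite ?conjgKV // mem_conjgV conjgKV.
  apply: mx_iso_simple simW0; apply: eqmx_iso; apply/eqmx_sym.
  exact: eqmx_trans (genmxE _) defCA.
- rewrite rankC -(divgS sM1N) cardJg divgS // -rankY -defA.
  by rewrite (eqnP freeA).
rewrite -(submxMfree _ _ freeA) mul1mx sumsmxMr_gen defA.
apply/sumsmx_subP=> y Ny; rewrite (sumsmx_sup (y ^ x^-1)%g) ?memJ_norm ?groupV //.
by rewrite genmxE -mulmxA homA ?memJ_norm ?groupV // conjgKV mulmxA (eqmxMr _ defCA).
Qed.

(** * Ordinary characters *)

Lemma cfRepr_ind (gT : finGroupType) (G H : {group gT}) (sHG : H \subset G) d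
    (rH : mx_representation algC H d) :
  cfRepr (ind_repr sHG rH) = 'Ind[G] (cfRepr rH).
Proof.
apply/cfun_inP=> x Gx; rewrite cfInd_rtrans // cfunE Gx mulr1n mxtrace_ind_mx.
by apply: eq_bigr => i _; rewrite cfunE; case: ifP => _; rewrite ?mulr1n ?mulr0n.
Qed.

(** Complex characters determine representations up to similarity, so an equality of characters
    yields an isomorphism with the induced module. *)
Lemma char_degrees_cfRepr (gT : finGroupType) (G : {group gT}) n
    (rG : mx_representation algC G n) d :
  char_degrees (cfRepr rG) d <-> induced_degree rG d.
Proof.
split=> [[H [_ [sHG /irr_reprP[rH irrH ->] defG]]] | [H [sHG [rH [irrH simH]]]]].
  rewrite cfRepr1 => /eqP; rewrite eqC_nat => /eqP <-.
  exists H, sHG, rH; split=> //; apply: cfRepr_inj.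
  by rewrite cfRepr_ind defG.
exists H, (cfRepr rH); split=> //; last by rewrite cfRepr1.
  by apply/irr_reprP; exists (Representation rH).
by rewrite -(cfRepr_ind sHG); apply: cfRepr_sim.
Qed.

Lemma is_gcd_of_1 (D : nat -> Prop) :
  is_gcd_of D 1 <-> forall k, (forall d, D d -> (k %| d)%N) -> (k %| 1)%N.
Proof. by split=> [[] | ] // gcdD; split. Qed.

Lemma pseudoM_group_repr (gT : finGroupType) (G : {group gT}) :
  pseudoM_group G <->
  forall n (rG : mx_representation algC G n), mx_irreducible rG -> pseudo_monomial_repr rG.
Proof.
split=> [pmG n rG irrG | pmG _ /irr_reprP[rG irrG ->]].
  have /is_gcd_of_1 gcdG : is_gcd_of (char_degrees (cfRepr rG)) 1.
    by apply: pmG; apply/irr_reprP; exists (Representation rG).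
  move=> k dvd_k; apply: gcdG => d /char_degrees_cfRepr; exact: dvd_k.
apply/is_gcd_of_1 => k dvd_k; apply: (pmG _ _ irrG) => d /char_degrees_cfRepr.
exact: dvd_k.
Qed.

(** * Representations with equal traces *)

(* The kernel of the group algebra acting through [r1] is killed by [rG], since
   the trace form is nondegenerate on the full matrix algebra; so [rG] factors
   through the enveloping algebra of [r1]. *)
Lemma mx_rsim_mxtrace (F : fieldType) (gT : finGroupType) (G : {group gT}) n
    (r1 rG : mx_representation F G n) :
    mx_absolutely_irreducible rG -> {in G, forall x, \tr (r1 x) = \tr (rG x)} ->
  mx_rsim r1 rG.
Proof.
move=> /[dup] absG /andP[n_gt0 fullG] eq_tr.
pose E1 := enveloping_algebra_mx r1; pose EG := enveloping_algebra_mx rG.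
have defE r (c : 'rV[F]_#|G|) :
    vec_mx (c *m enveloping_algebra_mx (r : mx_representation F G n))
    = \sum_i c 0 i *: r (enum_val i).
  rewrite mulmx_sum_row linear_sum /=; apply: eq_bigr => i _.
  by rewrite rowK linearZ /= mxvecK.
have ker0 (c : 'rV_#|G|) : c *m E1 = 0 -> c *m EG = 0.
  move=> c0; pose A := vec_mx (c *m EG).
  have trA x : x \in G -> \tr (A *m rG x) = 0.
    move=> Gx; rewrite /A defE mulmx_suml linear_sum /=.
    transitivity (\tr (vec_mx (c *m E1) *m r1 x)); last by rewrite c0 !linear0 mul0mx mxtrace0.
    rewrite defE mulmx_suml linear_sum /=; apply: eq_bigr => i _.
    have Gi := enum_valP i; rewrite -!scalemxAl !linearZ /= -!repr_mxM //.
    by rewrite eq_tr ?groupM.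
  have trAB B : \tr (A *m B) = 0.
    have /envelop_mxP[a ->] : (B \in EG)%MS by apply: submx_full.
    rewrite mulmx_sumr linear_sum big1 // => x Gx.
    by rewrite -scalemxAr linearZ /= trA ?mulr0.
  apply: (can_inj vec_mxK); rewrite linear0; apply/matrixP=> i j.
  have := trAB (delta_mx j i); rewrite -(mul_delta_mx (0 : 'I_1)) mulmxA mxtrace_mulC.
  by rewrite mulmxA -rowE -colE trace_mx11 !mxE.
have [D defD] : exists D, EG = E1 *m D.
  exists (pinvmx E1 *m EG); apply/row_matrixP=> i; apply/eqP; rewrite -subr_eq0.
  rewrite -linearB /= rowE -[X in X - _]mul1mx mulmxA -mulmxBl mulmxA; apply/eqP.
  by apply: ker0; rewrite -mulmxA mulmxBl mul1mx mulmxKpV // subrr mulmx0.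
have rEG : \rank EG = (n * n)%N by apply/eqP.
have full1 : row_full E1.
  by rewrite /row_full eqn_leq rank_leq_col -{1}rEG defD mxrankM_maxl.
have uD : row_free D.
  by rewrite row_free_unit -row_full_unit -sub1mx (submx_trans _ (submxMl E1 D)) // sub1mx -defD.
pose pi X := vec_mx (mxvec X *m D).
have pi_r x : x \in G -> pi (r1 x) = rG x.
  move=> Gx; have /(congr1 (row (enum_rank_in Gx x))) := defD.
  rewrite row_mul !rowK enum_rankK_in // => /(canRL mxvecK) eq_rG.
  by rewrite /pi -eq_rG.
have piM X x : x \in G -> pi (X *m r1 x) = pi X *m rG x.
  move=> Gx; have /envelop_mxP[a ->] : (X \in E1)%MS by apply: submx_full.
  rewrite mulmx_suml /pi !linear_sum /= !mulmx_suml !linear_sum /= mulmx_suml.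
  apply: eq_bigr => y Gy; rewrite -scalemxAl !linearZ /= -!scalemxAl !linearZ /=.
  rewrite -scalemxAl -repr_mxM // -[vec_mx _]/(pi _) pi_r ?groupM //.
  by rewrite -[vec_mx _]/(pi _) pi_r // repr_mxM.
pose i0 := Ordinal n_gt0.
pose e : 'cV[F]_n := delta_mx i0 0.
have [k nz_k] : exists k, row k (pi (e *m delta_mx 0 i0)) != 0.
  have: pi (e *m delta_mx 0 i0) != 0.
    rewrite /pi vec_mx_eq0 mulmx_free_eq0 // mxvec_eq0 /e mul_delta_mx.
    apply/eqP=> /matrixP/(_ i0 i0)/eqP.
    by rewrite !mxE !eqxx oner_eq0.
  rewrite -submx0 => /row_subPn[k]; rewrite submx0 => nz_k.
  by exists k.
(* [u] is sent to [e *m u], which embeds the module of [r1] in the matrices under right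
   multiplication; then come [pi] and a row on which the composite does not vanish. The result is a
   nonzero homomorphism to [rG]. *)
pose f := lin1_mx (row k \o vec_mx \o mulmxr D \o mxvec \o mulmx e).
have fE (u : 'rV_n) : u *m f = row k (pi (e *m u)) by rewrite mul_rV_lin1.
have homf x : x \in G -> r1 x *m f = f *m rG x.
  move=> Gx; apply/row_matrixP=> i; rewrite !rowE !mulmxA !fE mulmxA piM //.
  by rewrite row_mul.
have fullf : row_full f.
  have [_ irrG] := (mx_irrP rG).1 (mx_abs_irrW absG); apply: irrG.
    by apply/mxmoduleP=> x Gx; rewrite -homf // submxMl.
  by apply: contraNneq nz_k => f0; rewrite -fE f0 mulmx0.
by exists f; rewrite // row_free_unit -row_full_unit.
Qed.

(** * Algebraic integers *)

Lemma perm_map_ex (T1 T2 : eqType) (f : T1 -> T2) (s : seq T1) (t : seq T2) :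
  perm_eq t (map f s) -> exists2 s', perm_eq s' s & map f s' = t.
Proof.
case: s => [|x0 s0]; first by move/perm_nilP->; exists [::].
set s := x0 :: s0 => /(perm_iotaP (f x0))[Is]; rewrite size_map => pIs ->.
exists (map (nth x0 s) Is); first by apply/(perm_iotaP x0); exists Is.
rewrite -map_comp; apply/eq_in_map => i; rewrite (perm_mem pIs) mem_iota add0n.
by case/andP=> _ lti; rewrite (nth_map x0).
Qed.

Lemma prod_XsubC_map_inj (R : nzRingType) (S : nzRingType) (f : {rmorphism R -> S}) (s : seq R) :
  map_poly f (\prod_(x <- s) ('X - x%:P)) = \prod_(x <- map f s) ('X - x%:P).
Proof.
rewrite rmorph_prod big_map; apply: eq_bigr => x _ /=.
by rewrite rmorphB /= map_polyX map_polyC.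
Qed.

Definition algC_of : {rmorphism algInt -> algC} := val.

Lemma algC_of_inj : injective algC_of.
Proof. exact: val_inj. Qed.

Lemma algInt_ex x : x \in Aint -> exists z, algC_of z = x.
Proof. by move=> Ax; exists (AlgInt Ax). Qed.

Lemma algInt_root (z : algInt) :
  exists2 f : {poly int}, f \is monic & (map_poly intr f).[z] = 0.
Proof.
have Az : algC_of z \in Aint by apply: valP.
have /floorpP[f def_f] := Az; exists f.
  rewrite monicE -(inj_eq (intr_inj : injective (intr : int -> algC))).
  rewrite -lead_coef_map_inj //; last exact: intr_inj.
  rewrite -def_f; have [q [-> mon_q] _] := minCpolyP (algC_of z).
  by rewrite lead_coef_map (monicP mon_q) rmorph1.
apply: algC_of_inj; rewrite rmorph0 -horner_map -map_poly_comp.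
rewrite (eq_map_poly (g := intr)) => [|i]; last exact: (rmorph_int algC_of).
by rewrite -def_f; apply/rootP/root_minCpoly.
Qed.

Lemma Aint_integralP x : reflect (integralOver (intr : int -> algC) x) (x \in Aint).
Proof.
apply: (iffP idP) => [/algInt_ex[z <-] | [f mon_f fx0]].
  have [f mon_f fz0] := algInt_root z; exists f => //; apply/rootP.
  rewrite -(rmorph0 algC_of) -fz0 -horner_map -map_poly_comp.
  congr _.[_]; by apply: eq_map_poly => i; apply/esym/(rmorph_int algC_of).
apply: root_monic_Aint fx0 _ _; first exact: monic_map.
by apply/polyOverP=> i; rewrite coef_map /= intr_int.
Qed.

Lemma Aint_root_monic x (f : {poly algInt}) :
  f \is monic -> root (map_poly algC_of f) x -> x \in Aint.
Proof.
move=> mon_f fx0; apply/Aint_integralP.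
apply: integral_root_monic fx0 _; first exact: monic_map.
by move=> y /(nthP 0)[i _ <-]; rewrite coef_map; apply/Aint_integralP/valP.
Qed.

(** The complex eigenvalues are roots of a monic polynomial over the algebraic integers, hence
    algebraic integers, by transitivity of integrality. *)
Lemma char_poly_algInt n (A : 'M[algInt]_n) :
  exists2 s : seq algInt, char_poly A = \prod_(z <- s) ('X - z%:P)
    & forall k, \tr (A ^+ k) = \sum_(z <- s) z ^+ k.
Proof.
have [s0 char_s0 tr_s0] := char_poly_mxtrace_expr (map_mx algC_of A).
have [s def_s0] : exists s, map algC_of s = s0.
  have: {subset s0 <= Aint}.
    move=> x s0x; apply: (@Aint_root_monic _ (char_poly A)); first exact: char_poly_monic.
    by rewrite map_char_poly char_s0 root_prod_XsubC.
  elim: s0 {char_s0 tr_s0} => [|x s0 IHs] As0; first by exists [::].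
  have [|s <-] := IHs; first by move=> y s0y; rewrite As0 // inE s0y orbT.
  have [|z <-] := @algInt_ex x; first by rewrite As0 // mem_head.
  by exists (z :: s).
exists s => [|k].
  apply: (map_inj_poly algC_of_inj (rmorph0 _)).
  by rewrite map_char_poly char_s0 -def_s0 prod_XsubC_map_inj.
apply: algC_of_inj; rewrite -trace_map_mx.
have -> : map_mx algC_of (A ^+ k) = map_mx algC_of A ^+ k.
  elim: k => [|k IHk]; first by rewrite !expr0 map_mx1.
  by rewrite !exprS -IHk; apply: map_mxM.
rewrite tr_s0 -def_s0 big_map rmorph_sum; apply: eq_bigr => z _.
by rewrite rmorphXn.
Qed.

(** * Congruences modulo powers of p near the kernel of reduction *)

Section LocalCongruence.

Variables (p : nat) (F : fieldType) (red : {rmorphism algInt -> F}).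
Hypotheses (p_pr : prime p) (charF : p \in [pchar F]).

Let red_p : red p%:R = 0.
Proof. by rewrite rmorph_nat (pcharf0 charF). Qed.

(* Congruence modulo [p ^ k] in the localization of [algInt] at the kernel of [red]. *)
Definition local_cong k (x y : algInt) :=
  exists s r, red s != 0 /\ s * (x - y) = p%:R ^+ k * r.

Lemma local_cong_refl k x : local_cong k x x.
Proof. by exists 1, 0; rewrite rmorph1 oner_neq0 subrr !mulr0. Qed.

Lemma local_cong_sym k x y : local_cong k x y -> local_cong k y x.
Proof.
by case=> s [r [nzs eq_s]]; exists s, (- r); rewrite -opprB !mulrN eq_s.
Qed.

Lemma local_congD k x1 y1 x2 y2 :
  local_cong k x1 y1 -> local_cong k x2 y2 -> local_cong k (x1 + x2) (y1 + y2).
Proof.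
move=> [s1 [r1 [nz1 eq1]]] [s2 [r2 [nz2 eq2]]].
exists (s1 * s2), (s2 * r1 + s1 * r2); rewrite rmorphM mulf_neq0 //; split=> //.
have -> : s1 * s2 * (x1 + x2 - (y1 + y2)) = s2 * (s1 * (x1 - y1)) + s1 * (s2 * (x2 - y2)).
  by ring.
by rewrite eq1 eq2; ring.
Qed.

Lemma local_cong_trans k x y z : local_cong k x y -> local_cong k y z -> local_cong k x z.
Proof.
move=> cxy cyz; have [s [r [nzs eq_s]]] := local_congD cxy cyz.
by exists s, r; split=> //; rewrite -eq_s; congr (_ * _); ring.
Qed.

Lemma local_cong_sum k (I : Type) (s : seq I) (P : pred I) (f g : I -> algInt) :
    (forall i, P i -> local_cong k (f i) (g i)) ->
  local_cong k (\sum_(i <- s | P i) f i) (\sum_(i <- s | P i) g i).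
Proof.
move=> cfg; apply: (big_ind2 (local_cong k)) => //; first exact: local_cong_refl.
by move=> *; apply: local_congD.
Qed.

Lemma local_cong_leq k l x y : (l <= k)%N -> local_cong k x y -> local_cong l x y.
Proof.
move=> lelk [s [r [nzs eq_s]]]; exists s, (p%:R ^+ (k - l) * r); split=> //.
by rewrite eq_s mulrA -exprD subnKC.
Qed.

(** Binomial expansion of [(y + d) ^+ p], where [d] is locally divisible by [p ^ k]. The terms with
    [0 < j < p] gain a factor [p] from the binomial coefficient; the last one is divisible by
    [p ^ (k * p)], which suffices as [k > 0]. *)
Lemma local_cong_exp k x y : (0 < k)%N -> local_cong k x y ->
  local_cong k.+1 (x ^+ p) (y ^+ p).
Proof.
move=> k_gt0 [s [r [nzs eq_s]]]; pose d := x - y.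
have defx : x = y + d by rewrite /d addrC subrK.
exists (s ^+ p).
suffices [r' def_r'] : exists r', s ^+ p * ((y + d) ^+ p - y ^+ p) = p%:R ^+ k.+1 * r'.
  by exists r'; rewrite defx rmorphXn expf_neq0.
rewrite exprDn big_ord_recl /= subn0 expr0 mulr1 bin0 mulr1n addrAC subrr add0r mulr_sumr.
have ex_r (j : nat) : (0 < j <= p)%N ->
    exists r', s ^+ p * (y ^+ (p - j) * d ^+ j *+ 'C(p, j)) = p%:R ^+ k.+1 * r'.
  case/andP=> j_gt0 le_jp.
  have sd : s ^+ j * d ^+ j = p%:R ^+ (k * j) * r ^+ j.
    by rewrite -exprMn eq_s exprMn -exprM.
  have sp : s ^+ p = s ^+ (p - j) * s ^+ j by rewrite -exprD subnK.
  have [c [l [ltkl def_C]]] : exists c l, (k < k * j + l)%N /\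
      'C(p, j)%:R = p%:R ^+ l * c :> algInt.
    move: le_jp; rewrite leq_eqVlt => /predU1P[-> | lt_jp].
      exists 1, 0%N; rewrite binn expr0 mulr1 addn0; split=> //.
      by rewrite -{1}[k]muln1 ltn_pmul2l // prime_gt1.
    have /dvdnP[c def_c] : (p %| 'C(p, j))%N by rewrite prime_dvd_bin // j_gt0.
    exists c%:R, 1%N; rewrite def_c natrM mulrC expr1; split=> //.
    by rewrite addn1 ltnS leq_pmulr.
  exists (s ^+ (p - j) * y ^+ (p - j) * r ^+ j * c * p%:R ^+ (k * j + l - k.+1)).
  rewrite -mulr_natr def_C sp.
  transitivity (s ^+ (p - j) * y ^+ (p - j) * (s ^+ j * d ^+ j) * (p%:R ^+ l * c)).
    by ring.
  rewrite sd; transitivity (s ^+ (p - j) * y ^+ (p - j) * r ^+ j * c * p%:R ^+ (k * j + l)).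
    by rewrite exprD; ring.
  by rewrite -{1}(subnKC ltkl) exprD; ring.
elim/big_ind: _ => [|_ _ [r1 ->] [r2 ->] | i _]; first by exists 0; rewrite mulr0.
  by exists (r1 + r2); rewrite mulrDr.
by apply: ex_r; rewrite /bump add1n /=.
Qed.

Lemma red_int (i : int) : (red i%:~R == 0) = (p %| `|i|)%N.
Proof.
rewrite rmorph_int; case: i => n; first by rewrite -pmulrn (dvdn_pcharf charF).
by rewrite NegzE mulrNz oppr_eq0 -pmulrn abszN (dvdn_pcharf charF).
Qed.

(** In a monic integral equation [f] of [y], let [e] be the least index of a coefficient prime to
    [p]. The terms below [e] are divisible by [p]; the others sum to [h * y ^+ e], where [h] reduces
    to that coefficient and so is a local unit. *)
Lemma red0_exp (y : algInt) : red y = 0 -> exists e, local_cong 1 (y ^+ e.+1) 0.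
Proof.
move=> red_y; have [f mon_f fy0] := algInt_root y.
pose P i := ~~ (p %| `|(f`_i)%R|)%N.
have exP : exists i, P i.
  exists (size f).-1; rewrite /P; have := monicP mon_f; rewrite /lead_coef => ->.
  by rewrite dvdn1; case: p p_pr => [|[]].
have [e Pe min_e] := ex_minnP exP.
pose h := (map_poly intr (drop_poly e f) : {poly algInt}).[y].
have red_h : red h != 0.
  rewrite /h -horner_map red_y horner_coef0 !coef_map /= coef_drop_poly.
  by rewrite red_int.
have [r def_r] : exists r, (map_poly intr (take_poly e f) : {poly algInt}).[y] = p%:R * r.
  rewrite horner_coef; elim/big_ind: _ => [|_ _ [r1 ->] [r2 ->] | i _].
  - by exists 0; rewrite mulr0.
  - by exists (r1 + r2); rewrite mulrDr.
  rewrite coef_map /= coef_take_poly; case: ifP => lt_ie; last first.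
    by exists 0; rewrite mul0r mulr0.
  have /dvdnP[c def_c] : (p %| `|(f`_i)%R|)%N.
    by apply: contraLR lt_ie => /min_e; rewrite -leqNgt.
  have [a ->] : exists a : int, f`_i = p%:R * a.
    exists (sgz f`_i * c%:R); rewrite {1}[f`_i]intEsg def_c.
    by rewrite PoszM !natz; ring.
  by exists (a%:~R * y ^+ i); rewrite intrM natz -pmulrn mulrA.
have hy : h * y ^+ e = p%:R * - r.
  have := congr1 (fun g => (map_poly intr g : {poly algInt}).[y]) (poly_take_drop e f).
  rewrite rmorphD rmorphM /= map_polyXn hornerD hornerM hornerXn fy0 def_r => /eqP.
  by rewrite addrC addr_eq0 mulrN => /eqP.
have e_gt0 : (0 < e)%N.
  rewrite lt0n; apply: contraNneq red_h => e0; rewrite e0 expr0 mulr1 in hy.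
  by rewrite hy rmorphM red_p mul0r.
by exists e.-1, h, (- r); rewrite prednK // subr0 expr1.
Qed.

(** A nonzero difference [d] divides a nonzero integer [c], the constant term of an integral
    equation of [d] freed of powers of ['X]. Hence [d] cannot be locally divisible by all powers of
    [p]. *)
Lemma local_cong_eq (x y : algInt) : (forall k, local_cong k x y) -> x = y.
Proof.
move=> cxy; apply/eqP; rewrite -subr_eq0; apply/idPn; set d := x - y => nzd.
have [f mon_f fd0] := algInt_root d.
have [e [g not_g0 def_f]] := multiplicity_XsubC f 0.
rewrite monic_neq0 //= in not_g0.
have gd0 : (map_poly intr g : {poly algInt}).[d] = 0.
  have : (map_poly intr g : {poly algInt}).[d] * d ^+ e = 0.
    rewrite -fd0 def_f rmorphM rmorphXn /= rmorphB /= map_polyX map_polyC /= rmorph0 subr0.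
    by rewrite hornerM hornerXn.
  move/(congr1 algC_of)/eqP; rewrite rmorphM rmorphXn rmorph0 mulf_eq0 expf_eq0.
  by rewrite -(rmorph0 algC_of) !(inj_eq algC_of_inj) (negPf nzd) andbF orbF => /eqP.
pose c : int := g`_0; have nzc : c != 0 by move: not_g0; rewrite rootE horner_coef0.
have [u def_u] : exists u, c%:~R = d * u :> algInt.
  have := congr1 (fun h => (map_poly intr h : {poly algInt}).[d]) (poly_take_drop 1 g).
  rewrite rmorphD rmorphM /= map_polyXn hornerD hornerM hornerXn gd0 expr1.
  rewrite [take_poly 1 g](_ : _ = c%:P) ?map_polyC ?hornerC; last first.
    by apply/polyP=> i; rewrite coef_take_poly coefC; case: i.
  move/eqP; rewrite addr_eq0 => /eqP ->.
  by exists (- (map_poly intr (drop_poly 1 g)).[d]); rewrite mulrN mulrC.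
have [a [b [not_pb def_c]]] : exists a b, ~~ (p %| b)%N /\ `|c|%N = (p ^ a * b)%N.
  have c_gt0 : (0 < `|c|)%N by rewrite absz_gt0.
  have [b pb def_b] := pfactor_coprime p_pr c_gt0; exists (logn p `|c|), b.
  by rewrite -prime_coprime // mulnC.
(* The exponent is one more than the valuation of [c], so a factor [p] remains after cancelling
   [p ^ a]. *)
have [s [r [nzs eq_s]]] := cxy a.+1; rewrite -/d in eq_s.
have def_cz : c%:~R = p%:R ^+ a * (sgz c * b%:R)%:~R :> algInt.
  rewrite {1}[c]intEsg def_c PoszM -natrX !intrM !natz -!pmulrn.
  by rewrite mulrCA.
have : s * (sgz c * b%:R)%:~R = p%:R * (r * u).
  have nzpa : algC_of (p%:R ^+ a) != 0.
    rewrite rmorphXn rmorph_nat expf_neq0 // pnatr_eq0 -lt0n.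
    exact: prime_gt0.
  apply: algC_of_inj; apply: (mulfI nzpa); rewrite -!rmorphM; congr (algC_of _).
  by rewrite mulrCA -def_cz def_u [s * (d * u)]mulrA eq_s exprS; ring.
move/(congr1 red)/eqP; rewrite rmorphM [red (p%:R * _)]rmorphM red_p mul0r mulf_eq0.
have sgc : `|sgz c|%N = 1%N by case: sgzP nzc.
rewrite (negPf nzs) red_int abszM sgc mul1n natz /= => pb.
by rewrite pb in not_pb.
Qed.

End LocalCongruence.

(** * Traces of large p-power powers of lifted matrices *)

Section LiftTrace.

Variables (p : nat) (F : fieldType) (red : {rmorphism algInt -> F}).
Hypotheses (p_pr : prime p) (charF : p \in [pchar F]).

(** Modulo [p], raising to the power [q = p ^ e.+1] is additive, and [(x - z) ^+ q] vanishes locally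
    because already the power [e.+1] does. Each further [p]-th power then improves the congruence by
    one factor [p]. *)
Lemma local_cong_exp_red k x z : red x = red z ->
  exists N0, forall N, (N0 <= N)%N -> local_cong p red k (x ^+ (p ^ N)) (z ^+ (p ^ N)).
Proof.
move=> red_xz.
have step l N : (0 < l)%N -> local_cong p red l (x ^+ (p ^ N)) (z ^+ (p ^ N)) ->
    local_cong p red l.+1 (x ^+ (p ^ N.+1)) (z ^+ (p ^ N.+1)).
  by move=> l_gt0 /(local_cong_exp p_pr l_gt0); rewrite -!exprM -expnSr.
suffices [N0 cN0] : exists N0, local_cong p red 1 (x ^+ (p ^ N0)) (z ^+ (p ^ N0)).
  exists (N0 + k)%N => N leN; apply: (@local_cong_leq _ _ _ (N - N0).+1).
    by rewrite leqW // leq_subRL ?(leq_trans (leq_addr _ _) leN).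
  rewrite -{2 3}(subnKC (leq_trans (leq_addr k N0) leN)).
  elim: (N - N0)%N => [|m IHm]; first by rewrite addn0.
  by rewrite addnS; apply: step.
have red_d : red (x - z) = 0 by rewrite rmorphB red_xz subrr.
have [e ce] := red0_exp p_pr charF red_d.
exists e.+1; set q := (p ^ e.+1)%N.
have lt_eq : (e.+1 <= q)%N by rewrite ltnW // ltn_expl // prime_gt1.
have [s [r [nzs]]] := ce; rewrite subr0 expr1 => eq_s.
set y := x - z in eq_s; have defx : x = z + y by rewrite /y addrC subrK.
have frob (a b : algInt) : exists c, (a + b) ^+ p = a ^+ p + b ^+ p + p%:R * c.
  have neq_max : ord_max != ord0 :> 'I_p.+1 by rewrite -val_eqE /= -lt0n prime_gt0.
  rewrite exprDn (bigD1 ord0) // (bigD1 ord_max) //= subn0 subnn bin0 binn !expr0.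
  rewrite mulr1 mul1r !mulr1n addrA.
  suffices [c ->] : exists c, \sum_(i < p.+1 | (i != ord0) && (i != ord_max))
      a ^+ (p - i) * b ^+ i *+ 'C(p, i) = p%:R * c by exists c.
  elim/big_ind: _ => [|_ _ [r1 ->] [r2 ->] | i /andP[nz_i neq_ip]].
  - by exists 0; rewrite mulr0.
  - by exists (r1 + r2); rewrite mulrDr.
  have /dvdnP[c ->] : (p %| 'C(p, i))%N.
    rewrite prime_dvd_bin // lt0n nz_i ltn_neqAle -ltnS ltn_ord andbT.
    exact: neq_ip.
  exists (a ^+ (p - i) * b ^+ i *+ c).
  by rewrite mulrnA mulr_natl.
have [c def_c] : exists c, (z + y) ^+ q = z ^+ q + y ^+ q + p%:R * c.
  rewrite {lt_eq}/q; elim: e.+1 => [|N [c def_c]].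
    by exists 0; rewrite expn0 !expr1 mulr0 addr0.
  have [c1 def_c1] := frob (z ^+ (p ^ N) + y ^+ (p ^ N)) (p%:R * c).
  have [c2 def_c2] := frob (z ^+ (p ^ N)) (y ^+ (p ^ N)).
  exists (c2 + p%:R ^+ p.-1 * c ^+ p + c1).
  have expp : p%:R ^+ p = p%:R * p%:R ^+ p.-1 :> algInt.
    by rewrite -exprS prednK ?prime_gt0.
  by rewrite expnSr !exprM def_c def_c1 def_c2 exprMn expp; ring.
exists s, (r * y ^+ (q - e.+1) + s * c); split=> //.
have yq : y ^+ q = y ^+ (q - e.+1) * y ^+ e.+1 by rewrite -exprD subnK.
rewrite defx def_c expr1 yq.
transitivity (s * y ^+ e.+1 * y ^+ (q - e.+1) + s * p%:R * c); first by ring.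
by rewrite eq_s; ring.
Qed.

(** The eigenvalues of [A] and the roots [zs] have the same reductions, so they can be paired and
    compared term by term. *)
Lemma local_cong_mxtrace k n (A : 'M[algInt]_n) (zs : seq algInt) :
    char_poly (map_mx red A) = \prod_(z <- zs) ('X - (red z)%:P) ->
  exists N0, forall N, (N0 <= N)%N ->
    local_cong p red k (\tr (A ^+ (p ^ N))) (\sum_(z <- zs) z ^+ (p ^ N)).
Proof.
have [s char_s tr_s] := char_poly_algInt A.
rewrite -map_char_poly char_s prod_XsubC_map_inj -(big_map red predT (fun a => 'X - a%:P)).
move/prod_XsubC_eq; rewrite perm_sym => /perm_map_ex[s' perm_s red_s'].
have [N0 cN0] : exists N0, forall N, (N0 <= N)%N ->
    local_cong p red k (\sum_(z <- s') z ^+ (p ^ N)) (\sum_(z <- zs) z ^+ (p ^ N)).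
  elim: s' zs red_s' {perm_s} => [|x s' IHs] [|z zs] //=.
    by exists 0%N => N _; rewrite !big_nil; apply: local_cong_refl.
  case=> red_xz /IHs[N1 cN1]; have [N2 cN2] := local_cong_exp_red k red_xz.
  exists (maxn N1 N2) => N; rewrite geq_max => /andP[leN1 leN2].
  by rewrite !big_cons; apply: local_congD; [apply: cN2 | apply: cN1].
exists N0 => N leN; rewrite tr_s -(perm_big _ perm_s); exact: cN0.
Qed.

End LiftTrace.

(** * Brauer characters *)

Lemma repr_mx_expg (F : fieldType) (gT : finGroupType) (G : {group gT}) n
    (rG : mx_representation F G n) x k : x \in G -> rG (x ^+ k)%g = rG x ^+ k.
Proof.
move=> Gx; elim: k => [|k IHk]; first by rewrite expg0 expr0 repr_mx1.
by rewrite expgS exprS repr_mxM ?groupX // IHk.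
Qed.

Section BrauerCharacterTheory.

Variables (p : nat) (F : closedFieldType) (red : {rmorphism algInt -> F}).
Hypotheses (p_pr : prime p) (charF : p \in [pchar F]).
Hypothesis red_onto : forall a : F, exists z : algInt, red z = a.

Local Notation p'_root := (p'_unity_root p).
Local Notation Brauer_char_of := (is_Brauer_char_of p red).

Let nz_red_nat m : ~~ (p %| m)%N -> m%:R != 0 :> F.
Proof. by rewrite (dvdn_pcharf charF). Qed.

(** If [z] and [w] are distinct roots of unity with common exponent [m], then
    [(z ^+ m - w ^+ m) / (z - w)] is 0; but it reduces to [m] times a power of the nonzero
    [red w]. *)
Lemma p'_root_red_inj z w : p'_root z -> p'_root w -> red z = red w -> z = w.
Proof.
move=> [m1 [p'm1 z1]] [m2 [p'm2 w2]] red_zw; pose m := (m1 * m2)%N.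
have p'm : ~~ (p %| m)%N by rewrite Euclid_dvdM // negb_or p'm1.
have zm : z ^+ m = 1 by rewrite exprM z1 expr1n.
have wm : w ^+ m = 1 by rewrite /m mulnC exprM w2 expr1n.
apply/eqP; rewrite -subr_eq0; apply: contraR (nz_red_nat p'm) => nz_zw.
have sum0 : \sum_(i < m) z ^+ (m.-1 - i) * w ^+ i = 0.
  apply: algC_of_inj; rewrite rmorph0; apply/eqP.
  have /(congr1 algC_of)/eqP := subrXX z w m.
  rewrite zm wm subrr rmorph0 rmorphM eq_sym mulf_eq0 -{1}(rmorph0 algC_of).
  by rewrite (inj_eq algC_of_inj) (negPf nz_zw).
have nz_w : red w != 0.
  apply/eqP=> w0; have /(congr1 red)/eqP := wm; rewrite rmorphXn w0 rmorph1.
  by rewrite expr0n; case: (m) p'm => [|m']; rewrite ?dvdn0 //= eq_sym oner_eq0.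
have /(congr1 red) := sum0; rewrite rmorph_sum rmorph0.
rewrite (eq_bigr (fun _ => red w ^+ m.-1)) => [|i _]; last first.
  rewrite rmorphM !rmorphXn red_zw -exprD subnK //.
  by rewrite -ltnS prednK // (leq_ltn_trans _ (ltn_ord i)).
rewrite sumr_const card_ord -[red w ^+ _ *+ m]mulr_natr => /eqP.
rewrite mulf_eq0 expf_eq0 (negPf nz_w).
by rewrite andbF.
Qed.

Lemma p'_root_sum_uniq (s t : seq algInt) :
    (forall z, z \in s -> p'_root z) -> (forall z, z \in t -> p'_root z) ->
    \prod_(z <- s) ('X - (red z)%:P) = \prod_(z <- t) ('X - (red z)%:P) ->
  \sum_(z <- s) z = \sum_(z <- t) z.
Proof.
move=> p's p't; rewrite -2!(big_map red predT (fun a => 'X - a%:P)).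
move/prod_XsubC_eq/perm_map_ex=> [t' perm_t' red_t'].
rewrite -(perm_big _ perm_t') /=; congr bigop.
have: {in t', forall z, p'_root z} by move=> z; rewrite (perm_mem perm_t'); apply: p't.
elim: s t' red_t' p's {perm_t' p't} => [|x s IHs] [|z t'] //= [red_zx red_t'] p's p't'.
have -> : x = z.
  by apply: p'_root_red_inj (esym red_zx); [apply: p's | apply: p't']; apply: mem_head.
congr cons; by apply: IHs => // y y_in; [apply: p's | apply: p't']; rewrite inE y_in orbT.
Qed.

(** ['X^m - 1] splits over the algebraic integers, and [a] is a root of the reduction of this
    factorization. *)
Lemma red_unity_root m a : ~~ (p %| m)%N -> a ^+ m = 1 -> exists2 z, z ^+ m = 1 & red z = a.
Proof.
move=> p'm am; have m_gt0 : (0 < m)%N by rewrite lt0n; apply: contraNneq p'm => ->.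
have [w0 prim_w0] := C_prim_root_exists m_gt0.
have [w def_w] := algInt_ex (Aint_prim_root prim_w0).
rewrite -def_w in prim_w0.
have facX : \prod_(0 <= i < m) ('X - (w ^+ i)%:P) = 'X^m - 1 :> {poly algInt}.
  apply: (map_inj_poly algC_of_inj (rmorph0 _)).
  transitivity ('X^m - 1 : {poly algC}); last first.
    by rewrite rmorphB rmorph1; congr (_ - _); apply/esym/(map_polyXn algC_of).
  rewrite -(factor_Xn_sub_1 prim_w0) -(big_map (GRing.exp w) predT (fun z => 'X - z%:P)).
  by rewrite prod_XsubC_map_inj !big_map; apply: eq_bigr => i _; rewrite rmorphXn.
have /(congr1 (fun f => (map_poly red f).[a])) := facX.
rewrite rmorphB rmorph1 /= map_polyXn hornerD hornerN hornerXn hornerC am subrr.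
rewrite rmorph_prod horner_prod => /eqP; rewrite prodf_seq_eq0 => /hasP[i _ /=].
rewrite rmorphB /= map_polyX map_polyC hornerXsubC subr_eq0 => /eqP def_a.
exists (w ^+ i) => //; apply: algC_of_inj; rewrite !rmorphXn rmorph1.
by rewrite exprAC (prim_expr_order prim_w0) expr1n.
Qed.

Section OneRepr.

Variables (gT : finGroupType) (G : {group gT}) (n : nat).
Variable rG : mx_representation F G n.

Lemma Brauer_lift g m : g \in G -> ~~ (p %| m)%N -> (g ^+ m = 1)%g ->
  exists2 zs : seq algInt, forall z, z \in zs -> z ^+ m = 1
    & char_poly (rG g) = \prod_(z <- zs) ('X - (red z)%:P).
Proof.
move=> Gg p'm gm; have [s char_s _] := char_poly_mxtrace_expr (rG g).
suffices [zs zs1 def_s] : exists2 zs : seq algInt,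
    forall z, z \in zs -> z ^+ m = 1 & map red zs = s.
  by exists zs => //; rewrite char_s -def_s big_map.
have: {in s, forall a, a ^+ m = 1}.
  move=> a sa; have: eigenvalue (rG g) a by rewrite eigenvalue_root_char char_s root_prod_XsubC.
  case/eigenvalueP=> v va nzv; apply/eqP; rewrite -subr_eq0.
  have vX k : v *m rG g ^+ k = a ^+ k *: v.
    elim: k => [|k IHk]; first by rewrite !expr0 mulmx1 scale1r.
    by rewrite !exprS -[_ * _]/(_ *m _) mulmxA va -scalemxAl IHk scalerA.
  have := vX m; rewrite -repr_mx_expg // gm repr_mx1 mulmx1 => /eqP.
  rewrite -subr_eq0 -{1}[v]scale1r -scalerBl scaler_eq0 (negPf nzv) orbF.
  by rewrite -opprB oppr_eq0.
elim: s {char_s} => [|a s IHs] s1; first by exists [::].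
have [|zs zs1 <-] := IHs; first by move=> b sb; rewrite s1 // inE sb orbT.
have [|z zm <-] := @red_unity_root m a p'm; first by rewrite s1 ?mem_head.
by exists (z :: zs) => // y; rewrite inE => /predU1P[-> // | /zs1].
Qed.

Lemma p'_elt_exp g : g \in G -> p^'.-elt (g ^+ #|G|`_p)%g.
Proof.
move=> Gg; have dvd_o : (#[g ^+ #|G|`_p] %| #|G|`_p^')%N.
  by rewrite order_dvdn -expgM partnC ?cardG_gt0 // expg_cardG.
by apply: pnat_dvd dvd_o _; apply: part_pnat.
Qed.

Lemma p'_elt_order g : g \in G -> p^'.-elt g -> (g ^+ #|G|`_p^' = 1)%g.
Proof.
move=> Gg p'g; apply/eqP; rewrite -order_dvdn -(part_pnat_id p'g).
by rewrite partn_dvd ?cardG_gt0 // order_dvdG.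
Qed.

Lemma p'_cardG : ~~ (p %| #|G|`_p^')%N.
Proof. by rewrite -p'natE // part_pnat. Qed.

(** Values are chosen element by element; conjugate elements get equal values since their matrices
    are similar and the sum of the lifts is unique. *)
Lemma Brauer_char_exists : exists phi : 'CF(G), Brauer_char_of rG phi.
Proof.
pose is_value g (c : algC) := if (g \in G) && p^'.-elt g then
      exists zs : seq algInt, [/\ forall z, z \in zs -> p'_root z,
        char_poly (rG g) = \prod_(z <- zs) ('X - (red z)%:P)
        & c = algC_of (\sum_(z <- zs) z)]
    else c = 0.
have [f def_f] : exists f, forall g, is_value g (f g).
  apply: (@fin_all_exists _ (fun _ => algC) is_value) => g; rewrite /is_value.
  have [/andP[Gg p'g] | _] := boolP (_ && _); last by exists 0.
  have [zs zs1 char_zs] := Brauer_lift Gg p'_cardG (p'_elt_order Gg p'g).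
  exists (algC_of (\sum_(z <- zs) z)), zs; split=> // z /zs1 z1.
  by exists (#|G|`_p^')%N; split; first exact: p'_cardG.
have fP : is_class_fun <<G>> (finfun f).
  rewrite genGid; apply: intro_class_fun => [x y Gx Gy | x notGx]; last first.
    by have := def_f x; rewrite /is_value (negPf notGx).
  have := def_f x; have := def_f (x ^ y)%g; rewrite /is_value groupJ // p_eltJ Gx /=.
  case: ifP => [p'x [zs [zs1 char_zs ->]] [ts [ts1 char_ts ->]] | _ -> -> //].
  congr (algC_of _); apply: p'_root_sum_uniq => //; rewrite -char_zs -char_ts.
  apply: (@char_poly_sim _ _ _ _ (rG y^-1%g)); first by rewrite repr_mx_unit ?groupV.
  by rewrite -!repr_mxM ?groupJ ?groupV // conjgE !mulgA mulgK.
exists (Cfun 0 fP); split=> [g not_p'g | g Gg p'g]; rewrite cfunE.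
  by have := def_f g; rewrite /is_value (negPf not_p'g) andbF.
have := def_f g; rewrite /is_value Gg p'g => -[zs [zs1 char_zs ->]]; exists zs; split=> //.
by rewrite rmorph_sum.
Qed.

Lemma Brauer_char_valE phi g zs : Brauer_char_of rG phi -> g \in G -> p^'.-elt g ->
    (forall z, z \in zs -> p'_root z) ->
    char_poly (rG g) = \prod_(z <- zs) ('X - (red z)%:P) ->
  phi g = algC_of (\sum_(z <- zs) z).
Proof.
case=> _ phiP Gg p'g zs1 char_zs; have [ts [ts1 char_ts ->]] := phiP g Gg p'g.
rewrite (@p'_root_sum_uniq zs ts) -?char_zs -?char_ts //.
by rewrite rmorph_sum.
Qed.

Lemma Brauer_char1 phi : Brauer_char_of rG phi -> phi 1%g = n%:R.
Proof.
move=> phiP; rewrite (@Brauer_char_valE phi 1%g (nseq n 1)) ?p_elt1 //.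
- by rewrite big_nseq iter_addr addr0 rmorphMn rmorph1.
- by move=> z /nseqP[-> _]; exists 1%N; rewrite dvdn1 expr1 neq_ltn prime_gt1 ?orbT.
rewrite repr_mx1 big_nseq iter_mulr mulr1.
rewrite char_poly_trig ?scalar_mx_is_trig // -[n in RHS]card_ord -prodr_const.
by apply: eq_big => // i _; rewrite mxE eqxx (rmorph1 red).
Qed.

Lemma mxtrace_Brauer g zs : char_poly (rG g) = \prod_(z <- zs) ('X - (red z)%:P) ->
  \tr (rG g) = red (\sum_(z <- zs) z).
Proof.
have [s -> tr_s] := char_poly_mxtrace_expr (rG g).
rewrite -(big_map red predT (fun a => 'X - a%:P)) => /prod_XsubC_eq perm_s.
have := tr_s 1%N; rewrite expr1 => ->; rewrite (perm_big _ perm_s) big_map rmorph_sum.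
by apply: eq_bigr => z _; rewrite expr1.
Qed.

(** Frobenius is additive on eigenvalues. As it is also injective, traces at [p]-regular elements
    determine all traces. *)
Lemma mxtrace_exp_pchar g : g \in G ->
  \tr (rG (g ^+ #|G|`_p)%g) = \tr (rG g) ^+ (#|G|`_p)%N.
Proof.
move=> Gg; rewrite repr_mx_expg //.
have [s _ tr_s] := char_poly_mxtrace_expr (rG g).
have := tr_s 1%N; rewrite expr1 tr_s => ->.
have pq : [pchar F].-nat (#|G|`_p)%N by rewrite (eq_pnat _ (pcharf_eq charF)) part_pnat.
elim: s {tr_s} => [|a s IHs].
  by rewrite !big_nil expr0n gtn_eqF // part_gt0.
by rewrite !big_cons IHs expr1 -exprDn_pchar.
Qed.

End OneRepr.

Lemma Brauer_char_sim (gT : finGroupType) (G : {group gT}) n1 n2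
    (r1 : mx_representation F G n1) (r2 : mx_representation F G n2) (phi : 'CF(G)) :
  mx_rsim r1 r2 -> Brauer_char_of r1 phi -> Brauer_char_of r2 phi.
Proof.
case=> B eq_n freeB homB [phi0 phiP]; split=> // g Gg p'g.
have [zs [zs1 char_zs ->]] := phiP g Gg p'g; exists zs; split=> //.
rewrite -char_zs; case: n2 / eq_n r2 B freeB homB => r2 B freeB homB.
by apply/esym/(@char_poly_sim _ _ _ _ B); rewrite ?homB // -row_free_unit.
Qed.

(** The common Brauer character reduces to the traces at the [p]-regular powers [g ^+ q]. These are
    [q]-th powers of the traces at [g], which therefore agree, and equal traces imply similarity
    with the irreducible [r2]. *)
Lemma Brauer_char_rsim (gT : finGroupType) (G : {group gT}) n1 n2
    (r1 : mx_representation F G n1) (r2 : mx_representation F G n2) (phi : 'CF(G)) :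
    mx_irreducible r2 -> Brauer_char_of r1 phi -> Brauer_char_of r2 phi ->
  mx_rsim r1 r2.
Proof.
move=> irr2 phi1 phi2.
have eq_n : n1 = n2.
  have := Brauer_char1 phi1; rewrite (Brauer_char1 phi2) => /eqP.
  by rewrite eqC_nat => /eqP.
move: r1 phi1; rewrite eq_n => r1 phi1.
apply: mx_rsim_mxtrace; first exact: group_closure_closed_field.
move=> g Gg; pose q := (#|G|`_p)%N; have p'gq := p'_elt_exp Gg.
have [[_ phi1P] [_ phi2P]] := (phi1, phi2).
have [zs [zs1 char_zs phi_zs]] := phi1P _ (groupX q Gg) p'gq.
have [ts [ts1 char_ts]] := phi2P _ (groupX q Gg) p'gq.
rewrite phi_zs -!(rmorph_sum algC_of) => /algC_of_inj eq_zs.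
have : \tr (r1 g) ^+ q = \tr (r2 g) ^+ q.
  rewrite -!mxtrace_exp_pchar // (mxtrace_Brauer char_zs) (mxtrace_Brauer char_ts).
  by rewrite eq_zs.
have pq : [pchar F].-nat q by rewrite (eq_pnat _ (pcharf_eq charF)) part_pnat.
rewrite -{1}[\tr (r1 g)](subrK (\tr (r2 g))) exprDn_pchar // => /(canRL (addrK _)).
by rewrite subrr => /eqP; rewrite expf_eq0 subr_eq0 => /andP[_ /eqP].
Qed.

Lemma Brauer_char_ind (gT : finGroupType) (G H : {group gT}) (sHG : H \subset G) d
    (rH : mx_representation F H d) (psi : 'CF(H)) :
  Brauer_char_of rH psi -> Brauer_char_of (ind_repr sHG rH) ('Ind[G] psi).
Proof.
move=> psiP.
have tJ (i : 'I_#|rcosets H G|) g : (rtrans i * g * (rtrans i)^-1 = g ^ (rtrans i)^-1)%g.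
  by rewrite conjgE invgK mulgA.
split=> [g not_p'g | g Gg p'g].
  rewrite cfInd_rtrans // big1 // => i _; have [psi0 _] := psiP.
  by apply: psi0; rewrite tJ p_eltJ.
pose m := (#|G|`_p^')%N; have p'm : ~~ (p %| m)%N := p'_cardG G.
have gm : (g ^+ m = 1)%g := p'_elt_order Gg p'g.
have [zs zs1 char_zs] := Brauer_lift (ind_repr sHG rH) Gg p'm gm.
exists zs; split=> // [z /zs1 z1 | ]; first by exists m.
pose t (i : 'I_#|rcosets H G|) := (rtrans i * g * (rtrans i)^-1)%g.
have tm i : (t i ^+ m = 1)%g.
  by rewrite /t tJ -conjXg gm conj1g.
have p't i : p^'.-elt (t i) by rewrite /t tJ p_eltJ.
(* A coset moved by [g] gets the empty list, in accordance with [psi] vanishing outside [H]. *)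
pose lifts i (s : seq algInt) :=
  if t i \in H then [/\ forall z, z \in s -> z ^+ m = 1
    & char_poly (rH (t i)) = \prod_(z <- s) ('X - (red z)%:P)]
  else s = [::].
have [ts def_ts] : exists ts, forall i, lifts i (ts i).
  apply: (@fin_all_exists _ (fun _ => seq algInt) lifts) => i; rewrite /lifts.
  have [Ht | _] := boolP (t i \in H); last by exists [::].
  by have [ts ts1 char_ts] := Brauer_lift rH Ht p'm (tm i); exists ts.
have psi_t i : psi (t i) = algC_of (\sum_(z <- ts i) z).
  have := def_ts i; rewrite /lifts; have [Ht [ts1 char_ts] | notHt ->] := boolP (t i \in H).
    by apply: Brauer_char_valE psiP Ht (p't i) _ char_ts => z /ts1 z1; exists m.
  by rewrite big_nil cfun0 // rmorph0.
(* An entrywise lift, available as [red] is onto; no multiplicativity is claimed. *)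
have lift_ex : exists U : gT -> 'M[algInt]_d, forall x, map_mx red (U x) = rH x.
  have lift a : exists z, red z == a by have [z <-] := red_onto a; exists z.
  exists (fun x => map_mx (fun a => xchoose (lift a)) (rH x)) => x.
  by apply/matrixP=> a b; rewrite !mxE; apply/eqP/(xchooseP (lift _)).
have [U redU] := lift_ex.
rewrite cfInd_rtrans // (eq_bigr _ (fun i _ => psi_t i)) -rmorph_sum -[RHS](rmorph_sum algC_of).
congr (algC_of _); apply: (local_cong_eq p_pr charF) => k.
pose P := ind_mx G H U g.
have redP : map_mx red P = ind_repr sHG rH g.
  apply/matrixP=> a b; rewrite /P /= /ind_mx !mxE.
  by case: ifP => _; rewrite -?redU !mxE ?rmorph0.
have [N0 cN0] : exists N0, forall N, (N0 <= N)%N ->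
    local_cong p red k (\tr (P ^+ (p ^ N))) (\sum_(z <- zs) z ^+ (p ^ N)).
  by apply: local_cong_mxtrace; rewrite // redP.
have [N1 cN1] : exists N1, forall N i, (N1 <= N)%N -> t i \in H ->
    local_cong p red k (\tr (U (t i) ^+ (p ^ N))) (\sum_(z <- ts i) z ^+ (p ^ N)).
  pose bound i N0 := forall N, (N0 <= N)%N -> t i \in H ->
      local_cong p red k (\tr (U (t i) ^+ (p ^ N))) (\sum_(z <- ts i) z ^+ (p ^ N)).
  have [Nf cNf] : exists Nf, forall i, bound i (Nf i).
    apply: (@fin_all_exists _ (fun _ => nat) bound) => i; rewrite /bound.
    have := def_ts i; rewrite /lifts.
    case: ifP => [Ht [_ char_ts] | notHt _]; last by exists 0%N.
    have [Ni cNi] := local_cong_mxtrace p_pr charF k (etrans (congr1 char_poly (redU _)) char_ts).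
    by exists Ni => N leN _; apply: cNi.
  exists (\max_i Nf i) => N i leN; apply: cNf; apply: leq_trans leN; exact: leq_bigmax.
(* A multiple of [totient m], so that [p ^ N] is 1 modulo [m] by Euler and both [g] and the lifted
   eigenvalues are fixed by the power; it also exceeds both bounds. *)
pose N := (maxn N0 N1 * totient m)%N.
have pN : (p ^ N = 1 %[mod m])%N.
  by rewrite /N expnM Euler_exp_totient // coprimeXl // prime_coprime.
have zN (z : algInt) : z ^+ m = 1 -> z ^+ (p ^ N) = z.
  by move=> z1; rewrite -(expr_mod _ z1) pN expr_mod // expr1.
have gN : (g ^+ (p ^ N) = g)%g.
  by rewrite -(expg_mod _ gm) pN expg_mod // expg1.
have m_gt0 : (0 < m)%N by rewrite part_gt0.
have leN : (maxn N0 N1 <= N)%N by rewrite leq_pmulr ?totient_gt0.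
have trP : \tr (P ^+ (p ^ N)) = \sum_i (if t i \in H then \tr (U (t i) ^+ (p ^ N)) else 0).
  have pN_gt0 : (0 < p ^ N)%N by rewrite expn_gt0 prime_gt0.
  by rewrite -(prednK pN_gt0) mxtrace_ind_mx_exprS ?prednK.
apply: (@local_cong_trans _ _ _ _ _ (\tr (P ^+ (p ^ N)))); last first.
  have := cN0 N (leq_trans (leq_maxl _ _) leN); congr local_cong.
  by apply: eq_big_seq => z /zs1/zN.
rewrite trP; apply: local_cong_sum => i _; have := def_ts i; rewrite /lifts.
case: ifP => [Ht [ts1 _] | _ ->]; last by rewrite big_nil; apply: local_cong_refl.
apply: local_cong_sym; have := cN1 N i (leq_trans (leq_maxr _ _) leN) Ht.
by congr local_cong; apply: eq_big_seq => z /ts1/zN.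
Qed.

End BrauerCharacterTheory.

(** * From Brauer characters to modules *)

Section PseudoMp.

Variables (p : nat) (F : closedFieldType) (red : {rmorphism algInt -> F}).
Hypotheses (p_pr : prime p) (charF : p \in [pchar F]).
Hypothesis red_onto : forall a : F, exists z : algInt, red z = a.

Lemma Brauer_char_uniq (gT : finGroupType) (G : {group gT}) n
    (rG : mx_representation F G n) (phi psi : 'CF(G)) :
  is_Brauer_char_of p red rG phi -> is_Brauer_char_of p red rG psi -> phi = psi.
Proof.
move=> phiP [psi0 psiP]; apply/cfun_inP=> g Gg.
have [p'g | not_p'g] := boolP (p^'.-elt g); last by case: phiP => phi0 _; rewrite phi0 ?psi0.
have [zs [zs1 char_zs ->]] := psiP g Gg p'g.
by rewrite (Brauer_char_valE p_pr charF phiP Gg p'g zs1 char_zs) rmorph_sum.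
Qed.

Lemma Brauer_degrees_repr (gT : finGroupType) (G : {group gT}) n
    (rG : mx_representation F G n) (phi : 'CF(G)) d :
    mx_irreducible rG -> is_Brauer_char_of p red rG phi ->
  Brauer_degrees p red phi d <-> induced_degree rG d.
Proof.
move=> irrG phiP; split=> [[H [psi [sHG [m [rH [irrH psiP]]] def_phi]]] | ].
  rewrite (Brauer_char1 p_pr charF psiP) => /eqP; rewrite eqC_nat => /eqP <-.
  exists H, sHG, rH; split=> //; apply: (Brauer_char_rsim p_pr charF irrG) phiP.
  by rewrite -def_phi; apply: Brauer_char_ind.
case=> H [sHG [rH [irrH simH]]].
have [psi psiP] := Brauer_char_exists red p_pr charF rH.
exists H, psi; split=> //; first by exists d, rH.
  have indP := Brauer_char_ind p_pr charF red_onto sHG psiP.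
  exact: Brauer_char_uniq (Brauer_char_sim simH indP) phiP.
exact: Brauer_char1 psiP.
Qed.

Lemma pseudoMp_group_repr (gT : finGroupType) (G : {group gT}) :
  pseudoMp_group p red G <->
  forall n (rG : mx_representation F G n), mx_irreducible rG -> pseudo_monomial_repr rG.
Proof.
split=> [pmG n rG irrG | pmG phi [n [rG [irrG phiP]]]].
  have [phi phiP] := Brauer_char_exists red p_pr charF rG.
  have /is_gcd_of_1 gcdG : pseudo_monomial p red phi by apply: pmG; exists n, rG.
  move=> k dvd_k; apply: gcdG => d /(Brauer_degrees_repr _ irrG phiP); exact: dvd_k.
apply/is_gcd_of_1 => k dvd_k; apply: (pmG _ _ irrG) => d.
by move/(Brauer_degrees_repr _ irrG phiP); apply: dvd_k.
Qed.

End PseudoMp.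

Theorem theorem4 (gT : finGroupType) (G N : {group gT})
    (nNG : (N <| G)%g) (hallN : Hall G N) :
  (pseudoM_group G -> pseudoM_group N) /\
  (forall (p : nat) (F : closedFieldType) (red : {rmorphism algInt -> F}),
     prime p -> p \in [pchar F]%R -> (forall a : F, exists z : algInt, red z = a) ->
     pseudoMp_group p red G -> pseudoMp_group p red N).
Proof.
split=> [/pseudoM_group_repr pmG | p F red p_pr charF red_onto pmG].
  by apply/pseudoM_group_repr; apply: pseudo_monomial_repr_Hall nNG hallN pmG.
apply/(pseudoMp_group_repr p_pr charF red_onto).
apply: pseudo_monomial_repr_Hall nNG hallN _.
exact/(pseudoMp_group_repr p_pr charF red_onto).
Qed.
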